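(* Let $\phi:\Gamma\to\Delta$ be a homomorphism of Lie groupoids which covers the identity (i.e., $\Gamma$ and $\Delta$ have the same base manifold $X$ and $\phi$ induces $\mathrm{id}_X$ on the base) and which is fully faithful as an abstract functor. Then $\phi$ is an isomorphism of Lie groupoids.
   Context: A smooth manifold is a non-empty $C^\infty$ manifold of constant dimension whose topology is Hausdorff and second countable. A Lie groupoid $\Gamma\rightrightarrows X$ is a groupoid whose set of objects $X$ (its base) and set of arrows are smooth manifolds, with source and target submersive $C^\infty$ maps and composition, unit and inverse maps of class $C^\infty$. A homomorphism is a $C^\infty$ functor; an isomorphism is a homomorphism with an inverse that is also a homomorphism. *)

(* Defs.v *)
From mathcomp Require Import all_boot all_order all_algebra.
From mathcomp Require Import all_classical all_reals all_analysis.
Set Implicit Arguments. Unset Strict Implicit. Unset Printing Implicit Defensive.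
Import Order.TTheory GRing.Theory Num.Theory.
Import numFieldNormedType.Exports.
Local Open Scope classical_set_scope.
Local Open Scope ring_scope.

(* The predicates [Ck], [Cinf] and [smooth_in] are meant for an open set [U]
   (resp. [W]); the values of the total function outside it are irrelevant. *)
Fixpoint Ck (R : realType) (n m k : nat) (U : set 'rV[R]_n)
    (f : 'rV[R]_n -> 'rV[R]_m) : Prop :=
  match k with
  | 0 => forall x, U x -> {for x, continuous f}
  | k'.+1 => (forall x, U x -> differentiable f x) /\
             (forall v, Ck k' U (fun x => 'D_v f x))
  end.

Definition Cinf (R : realType) (n m : nat) (U : set 'rV[R]_n)
  (f : 'rV[R]_n -> 'rV[R]_m) : Prop := forall k, Ck k U f.

Section Ck_lemmas.
Variable R : realType.

Lemma near_differentiable (V W : normedModType R) (f g : V -> W) (x : V) :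
  (\near x, f x = g x) -> differentiable f x -> differentiable g x.
Proof.
move=> fg df; have -> : g = f + (g - f).
  by rewrite addrCA subrr addr0.
apply: differentiableD => //; set e := g - f.
have ex0 : e x = 0 by rewrite /e !fctE (nbhs_singleton fg) subrr.
have he : e \o shift x = cst (e x) + (\0 : V -> W) +o_ 0 id.
  apply/eqaddoP => _/posnumP[eps]; near=> h.
  rewrite !fctE /= ex0 /e !fctE.
  have -> : f (h + x) = g (h + x).
    near: h; have := fg; rewrite (near_shift 0) /=.
    by apply: filterS => h; rewrite /= subr0 => ->.
  by rewrite subrr addr0 subr0 normr0 mulr_ge0.
have d0 := @diff_unique R V W e \0 x (fun=> cvg_cst _) he.
by apply/diff_locallyP; rewrite d0; split=> // ?; exact: cvg_cst.
Unshelve. all: by end_near. Qed.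

Lemma open_near n (U : set 'rV[R]_n) (P : 'rV[R]_n -> Prop) x :
  open U -> U x -> (forall x, U x -> P x) -> \near x, P x.
Proof.
by move=> oU Ux UP; apply: filterS UP _; exact: open_nbhs_nbhs.
Qed.

Lemma Ck_sub n m k (U V : set 'rV[R]_n) (f : 'rV[R]_n -> 'rV[R]_m) :
  U `<=` V -> Ck k V f -> Ck k U f.
Proof.
move=> UV; elim: k f => [|k IH] f /=; first by move=> h x /UV; exact: h.
by move=> [h1 h2]; split=> [x /UV /h1 //|v]; exact: IH.
Qed.

Lemma Ck_ext n m k (U : set 'rV[R]_n) (f g : 'rV[R]_n -> 'rV[R]_m) :
  open U -> (forall x, U x -> f x = g x) -> Ck k U f -> Ck k U g.
Proof.
move=> oU; elim: k f g => [|k IH] f g fg /=.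
  move=> h x Ux; have fx : (f y @[y --> x] --> f x) by exact: h.
  have fgx : {near nbhs x, f =1 g}.
    exact: (@open_near _ U (fun y => f y = g y) x oU Ux fg).
  have gx := cvg_trans (near_eq_cvg fgx) fx.
  by rewrite (fg x Ux) in gx; exact: gx.
move=> [h1 h2]; split=> [x Ux|v].
  exact: near_differentiable (@open_near _ U (fun y => f y = g y) x oU Ux fg) (h1 x Ux).
apply: IH (h2 v) => x Ux; apply: near_eq_derive.
exact: (@open_near _ U (fun y => f y = g y) x oU Ux fg).
Qed.

Lemma CkD n m k (U : set 'rV[R]_n) (f g : 'rV[R]_n -> 'rV[R]_m) :
  open U -> Ck k U f -> Ck k U g -> Ck k U (fun x => f x + g x).
Proof.
move=> oU; elim: k f g => [|k IH] f g /=.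
  by move=> hf hg x Ux; apply: (@continuousD _ _ _ f g); [exact: hf|exact: hg].
move=> [f1 f2] [g1 g2]; split=> [x Ux|v].
  by apply: (@differentiableD _ _ _ f g); [exact: f1|exact: g1].
apply: Ck_ext (IH _ _ (f2 v) (g2 v)) => // x Ux.
by rewrite -(@deriveD _ _ _ f g) //; apply: diff_derivable; [exact: f1|exact: g1].
Qed.

Lemma continuous_to_mx (T : topologicalType) m n (f : T -> 'M[R]_(m, n)) x :
  (forall i j, (fun y => f y i j) @ x --> f x i j) -> f @ x --> f x.
Proof.
move=> h A [P nP sPA].
have hP : \forall y \near x, forall i j, P i j (f y i j).
  by apply: filter_forall => i; apply: filter_forall => j; exact: (h i j _ (nP i j)).
by move: hP; apply: filterS => y /sPA.
Qed.

Lemma linear_rV_continuous n m (L : {linear 'rV[R]_n -> 'rV[R]_m}) :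
  continuous L.
Proof.
move=> x; apply: continuous_to_mx => i j.
have -> : (fun y => L y i j) = (fun y : 'rV[R]_n => \sum_k y 0 k * lin1_mx L k j).
  by apply/funext => y; rewrite -mul_rV_lin1 mxE ord1.
have -> : L x i j = \sum_k x 0 k * lin1_mx L k j.
  by rewrite -mul_rV_lin1 mxE ord1.
have cvk k : (fun y : 'rV[R]_n => y 0 k * lin1_mx L k j) @ x --> x 0 k * lin1_mx L k j.
  exact: (@cvgMr_tmp _ _ (nbhs x) _ (fun y : 'rV[R]_n => y 0 k) _ _
    (@coord_continuous R 1 n 0 k x)).
have addc : continuous (fun z : R * R => z.1 + z.2).
  by move=> z; exact: (@add_continuous R^o).
exact: (@cvg_big R _ +%R 0 xpredT addc _ (nbhs x)
  (index_enum 'I_n) (fun k (y : 'rV[R]_n) => y 0 k * lin1_mx L k j)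
  (fun k => x 0 k * lin1_mx L k j) (nbhs_filter x) (fun k _ => cvk k)).
Qed.

Lemma Ck_comp_linear n m p q k (U : set 'rV[R]_n) (f : 'rV[R]_n -> 'rV[R]_m)
    (L : {linear 'rV[R]_p -> 'rV[R]_n}) (L' : {linear 'rV[R]_m -> 'rV[R]_q}) :
  open U -> Ck k U f -> Ck k (L @^-1` U) (fun x => L' (f (L x))).
Proof.
have cL := @linear_rV_continuous _ _ L; have cL' := @linear_rV_continuous _ _ L'.
move=> oU; elim: k f => [|k IH] f /=.
  move=> h x Ux; apply: (@continuous_comp _ _ _ (f \o L) L'); last exact: cL'.
  by apply: (@continuous_comp _ _ _ L f); [exact: cL|exact: h].
have dL x : differentiable L x by exact: linear_differentiable.
have dL' x : differentiable L' x by exact: linear_differentiable.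
move=> [h1 h2]; have dfL x : U (L x) -> differentiable (f \o L) x.
  by move=> Ux; apply: differentiable_comp => //; exact: h1.
have d1 x : U (L x) -> differentiable (L' \o (f \o L)) x.
  by move=> Ux; apply: differentiable_comp => //; exact: dfL.
split=> // v; apply: Ck_ext (IH _ (h2 (L v))).
  by apply: open_comp => // x _; exact: cL.
move=> x Ux; have -> : (fun x => L' (f (L x))) = L' \o (f \o L) by [].
rewrite (deriveE _ (d1 x Ux)) (deriveE _ (h1 _ Ux)).
rewrite (diff_comp (dfL x Ux) (dL' _)) /= (diff_comp (dL x) (h1 _ Ux)) /=.
by rewrite !diff_lin.
Qed.

End Ck_lemmas.
Record chart (R : realType) (T : topologicalType) (n : nat) := Chart {
  cdom : set T;
  cmap : T -> 'rV[R]_n;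
  cinv : 'rV[R]_n -> T;
  cdom_open : open cdom;
  cimg_open : open (cmap @` cdom);
  cmap_continuous : forall x, cdom x -> {for x, continuous cmap};
  cinv_continuous : forall u, (cmap @` cdom) u -> {for u, continuous cinv};
  cmapK : forall x, cdom x -> cinv (cmap x) = x }.

(* The atlas is not required to be maximal: it determines the smooth structure
   of its maximal extension, and smoothness of maps is tested on it alone. *)
Record manifold (R : realType) := Manifold {
  msort :> topologicalType;
  mdim : nat;
  atlas : set (chart R msort mdim);
  mnonempty : [set: msort] !=set0;
  mhausdorff : hausdorff_space msort;
  msecond_countable : @second_countable msort;
  atlas_cover : forall x, exists2 c, atlas c & cdom c x;
  atlas_compat : forall c d, atlas c -> atlas d ->
    Cinf (cmap c @` (cdom c `&` cdom d)) (cmap d \o cinv c) }.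

Definition smooth_in (R : realType) (M N : manifold R) (W : set M)
    (f : M -> N) : Prop :=
  (forall x, W x -> {for x, continuous f}) /\
  forall c d, atlas c -> atlas d ->
    Cinf (cmap c @` (W `&` cdom c `&` f @^-1` cdom d))
         (cmap d \o f \o cinv c).

Definition smooth (R : realType) (M N : manifold R) (f : M -> N) : Prop :=
  smooth_in setT f.

(* Smoothness on an arbitrary subset, by local smooth extension; on an embedded
   submanifold this is smoothness for its manifold structure. *)
Definition smooth_on (R : realType) (M N : manifold R) (A : set M)
    (f : M -> N) : Prop :=
  forall x, A x -> exists (W : set M) (F : M -> N),
    [/\ open W, W x, smooth_in W F & forall y, A y -> W y -> F y = f y].

Definition submersion (R : realType) (M N : manifold R) (f : M -> N) : Prop :=
  smooth f /\
  forall x c d, atlas c -> atlas d -> cdom c x -> cdom d (f x) ->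
    set_surj setT setT ('d (cmap d \o f \o cinv c) (cmap c x)).

Section product.
Variable R : realType.

Lemma open_prod (T U : topologicalType) (A : set T) (B : set U) :
  open A -> open B -> open (A `*` B).
Proof.
move=> oA oB; apply: openI.
  by apply: (@open_comp _ _ fst) => // x _; exact: cvg_fst.
by apply: (@open_comp _ _ snd) => // x _; exact: cvg_snd.
Qed.

Lemma nbhs_prod (T U : topologicalType) (x : T) (y : U) (A : set T) (B : set U) :
  nbhs x A -> nbhs y B -> nbhs (x, y) (A `*` B).
Proof. by move=> nA nB; exists (A, B). Qed.

Lemma hausdorff_prod (T U : topologicalType) :
  hausdorff_space T -> hausdorff_space U -> hausdorff_space (T * U)%type.
Proof.
move=> hT hU [x y] [x' y'] cl; congr pair.
  apply: hT => A B nA nB.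
  have [[a b] [/= Aa Ba]] := cl _ _ (nbhs_prod nA (filterT : nbhs y setT))
    (nbhs_prod nB (filterT : nbhs y' setT)).
  by exists a; split; [exact: Aa.1|exact: Ba.1].
apply: hU => A B nA nB.
have [[a b] [/= Aa Ba]] := cl _ _ (nbhs_prod (filterT : nbhs x setT) nA)
  (nbhs_prod (filterT : nbhs x' setT) nB).
by exists b; split; [exact: Aa.2|exact: Ba.2].
Qed.

Lemma second_countable_prod (T U : topologicalType) :
  @second_countable T -> @second_countable U -> @second_countable (T * U)%type.
Proof.
move=> [B cB [oB bB]] [C cC [oC bC]].
exists ((fun p => p.1 `*` p.2) @` (B `*` C)).
  by apply: (sub_countable (card_image_le _ _)); exact: countableX.
split=> [_ [[b c] [/= Bb Cc] <-]|[x y] A [[V W] [/= nV nW] VWA]].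
  by apply: open_prod; [exact: oB|exact: oC].
have [b [Bb bx] bV] := bB x V nV; have [c [Cc cy] cW] := bC y W nW.
exists (b `*` c); first by split=> //; exists (b, c).
by move=> [u v] [/= bu cv]; apply: VWA; split; [exact: bV|exact: cW].
Qed.

Lemma row_mxE_linear n p (u : 'rV[R]_n) (v : 'rV[R]_p) :
  row_mx u v = mulmxr (row_mx 1%:M 0) u + mulmxr (row_mx 0 1%:M) v.
Proof. by rewrite /= !mul_mx_row !mulmx1 !mulmx0 add_row_mx addr0 add0r. Qed.

Lemma continuous_linear_comp (T : topologicalType) n p (f : T -> 'rV[R]_n)
    (L : {linear 'rV[R]_n -> 'rV[R]_p}) x : {for x, continuous f} ->
  {for x, continuous (fun y => L (f y))}.
Proof.
move=> cf; apply: (@continuous_comp _ _ _ f L) => //.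
exact: linear_rV_continuous.
Qed.

Lemma continuous_row_mx (T : topologicalType) n p (f : T -> 'rV[R]_n)
    (g : T -> 'rV[R]_p) x : {for x, continuous f} -> {for x, continuous g} ->
  {for x, continuous (fun y => row_mx (f y) (g y))}.
Proof.
move=> /(@continuous_linear_comp _ _ _ _ (mulmxr (row_mx 1%:M (0 : 'M[R]_(n, p))))) cf.
move=> /(@continuous_linear_comp _ _ _ _ (mulmxr (row_mx (0 : 'M[R]_(p, n)) 1%:M))) cg.
have := @continuousD _ _ _ _ _ _ cf cg; congr (continuous_at _ _).
by apply/funext => y; rewrite row_mxE_linear.
Qed.

Section prod_chart.
Variables (S T : topologicalType) (n p : nat).
Variables (c : chart R S n) (d : chart R T p).

Definition prod_cdom : set (S * T) := cdom c `*` cdom d.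
Definition prod_cmap (x : S * T) : 'rV[R]_(n + p) :=
  row_mx (cmap c x.1) (cmap d x.2).
Definition prod_cinv (u : 'rV[R]_(n + p)) : S * T :=
  (cinv c (lsubmx u), cinv d (rsubmx u)).

Lemma prod_cimgE : prod_cmap @` prod_cdom =
  (lsubmx @^-1` (cmap c @` cdom c)) `&` (rsubmx @^-1` (cmap d @` cdom d)).
Proof.
apply/seteqP; split=> [_ [[x y] [/= cx dy] <-]|u [[x cx xu] [y dy yu]]].
  by rewrite /prod_cmap /=; split; rewrite /= ?row_mxKl ?row_mxKr; [exists x|exists y].
by exists (x, y) => //; rewrite /prod_cmap /= xu yu hsubmxK.
Qed.

Lemma open_lsubmx (U : set 'rV[R]_n) : open U ->
  open ((lsubmx : 'rV[R]_(n + p) -> _) @^-1` U).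
Proof. by move=> oU; apply: open_comp => // x _; exact: continuous_lsubmx. Qed.

Lemma open_rsubmx (U : set 'rV[R]_p) : open U ->
  open ((rsubmx : 'rV[R]_(n + p) -> _) @^-1` U).
Proof. by move=> oU; apply: open_comp => // x _; exact: continuous_rsubmx. Qed.

Lemma prod_cdom_open : open prod_cdom.
Proof. by apply: open_prod; exact: cdom_open. Qed.

Lemma prod_cimg_open : open (prod_cmap @` prod_cdom).
Proof.
rewrite prod_cimgE; apply: openI.
  by apply: open_lsubmx; exact: cimg_open.
by apply: open_rsubmx; exact: cimg_open.
Qed.

Lemma prod_cmap_continuous x : prod_cdom x -> {for x, continuous prod_cmap}.
Proof.
move=> [cx dx]; apply: continuous_row_mx.
  apply: (@continuous_comp _ _ _ fst (cmap c)); first exact: cvg_fst.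
  exact: cmap_continuous.
apply: (@continuous_comp _ _ _ snd (cmap d)); first exact: cvg_snd.
exact: cmap_continuous.
Qed.

Lemma prod_cinv_continuous u : (prod_cmap @` prod_cdom) u ->
  {for u, continuous prod_cinv}.
Proof.
rewrite prod_cimgE => -[cu du].
have c1 : {for u, continuous (cinv c \o lsubmx)}.
  by apply: continuous_comp (cinv_continuous cu); exact: continuous_lsubmx.
have c2 : {for u, continuous (cinv d \o rsubmx)}.
  by apply: continuous_comp (cinv_continuous du); exact: continuous_rsubmx.
exact: (cvg_pair c1 c2).
Qed.

Lemma prod_cmapK x : prod_cdom x -> prod_cinv (prod_cmap x) = x.
Proof.
case: x => x y [/= cx dy].
by rewrite /prod_cinv /prod_cmap row_mxKl row_mxKr !cmapK.
Qed.

Definition prod_chart : chart R (S * T)%type (n + p) :=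
  Chart prod_cdom_open prod_cimg_open prod_cmap_continuous
    prod_cinv_continuous prod_cmapK.

End prod_chart.

Lemma open_overlap (T : topologicalType) n (c : chart R T n) (A : set T) :
  open A -> open (cmap c @` (cdom c `&` A)).
Proof.
move=> oA; rewrite openE => _ [x [cx Ax] <-]; rewrite /interior.
have imx : (cmap c @` cdom c) (cmap c x) by exists x.
have n1 : nbhs (cmap c x) (cmap c @` cdom c).
  by apply: open_nbhs_nbhs; split=> //; exact: cimg_open.
have n2 : nbhs (cmap c x) (cinv c @^-1` A).
  by apply: (cinv_continuous imx); rewrite cmapK //; exact: open_nbhs_nbhs.
apply: filterS (filterI n1 n2) => _ [[y cy <-]] /=.
by rewrite cmapK // => Ay; exists y.
Qed.

Section prod_manifold.
Variables M N : manifold R.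

Definition prod_atlas : set (chart R (M * N)%type (mdim M + mdim N)) :=
  (fun cd => prod_chart cd.1 cd.2) @` (@atlas R M `*` @atlas R N).

Lemma prod_atlas_cover x : exists2 c, prod_atlas c & cdom c x.
Proof.
case: x => x y; have [c ac cx] := atlas_cover x; have [d ad dy] := atlas_cover y.
by exists (prod_chart c d) => //; exists (c, d).
Qed.

Lemma prod_atlas_compat c d : prod_atlas c -> prod_atlas d ->
  Cinf (cmap c @` (cdom c `&` cdom d)) (cmap d \o cinv c).
Proof.
move=> [[c1 c2] [/= ac1 ac2] <-] [[d1 d2] [/= ad1 ad2] <-] k.
have o1 := @open_overlap _ _ c1 _ (cdom_open d1).
have o2 := @open_overlap _ _ c2 _ (cdom_open d2).
apply: (@Ck_sub _ _ _ _ _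
  ((lsubmx @^-1` (cmap c1 @` (cdom c1 `&` cdom d1))) `&`
   (rsubmx @^-1` (cmap c2 @` (cdom c2 `&` cdom d2))))).
  move=> _ [[x y] [[/= cx cy] [/= dx dy]] <-].
  by split; rewrite /= /prod_cmap /= ?row_mxKl ?row_mxKr; [exists x|exists y].
have -> : cmap (prod_chart d1 d2) \o cinv (prod_chart c1 c2) = fun u =>
    mulmxr (row_mx 1%:M 0) ((cmap d1 \o cinv c1) (lsubmx u)) +
    mulmxr (row_mx 0 1%:M) ((cmap d2 \o cinv c2) (rsubmx u)).
  by apply/funext => u; rewrite -row_mxE_linear.
apply: CkD.
- by apply: openI; [exact: open_lsubmx|exact: open_rsubmx].
- apply: (@Ck_sub _ _ _ _ _ (lsubmx @^-1` (cmap c1 @` (cdom c1 `&` cdom d1)))).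
    exact: subIsetl.
  by apply: Ck_comp_linear => //; exact: atlas_compat.
- apply: (@Ck_sub _ _ _ _ _ (rsubmx @^-1` (cmap c2 @` (cdom c2 `&` cdom d2)))).
    exact: subIsetr.
  by apply: Ck_comp_linear => //; exact: atlas_compat.
Qed.

Lemma prod_nonempty : [set: M * N] !=set0.
Proof.
by have [x _] := mnonempty M; have [y _] := mnonempty N; exists (x, y).
Qed.

Definition prod_manifold : manifold R :=
  Manifold prod_nonempty (hausdorff_prod (@mhausdorff R M) (@mhausdorff R N))
    (second_countable_prod (@msecond_countable R M) (@msecond_countable R N))
    prod_atlas_cover prod_atlas_compat.

End prod_manifold.
End product.

(* [gcomp g h] is the composite "g after h"; it is meaningful only when
   [src g = tgt h], and its other values are arbitrary.  As [src] and [tgt] are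
   submersions, the composable pairs form an embedded submanifold. *)
Record lieGroupoid (R : realType) (X : manifold R) := LieGroupoid {
  arrows : manifold R;
  src : arrows -> X;
  tgt : arrows -> X;
  gunit : X -> arrows;
  ginv : arrows -> arrows;
  gcomp : arrows -> arrows -> arrows;
  src_unit : forall x, src (gunit x) = x;
  tgt_unit : forall x, tgt (gunit x) = x;
  src_inv : forall g, src (ginv g) = tgt g;
  tgt_inv : forall g, tgt (ginv g) = src g;
  src_comp : forall g h, src g = tgt h -> src (gcomp g h) = src h;
  tgt_comp : forall g h, src g = tgt h -> tgt (gcomp g h) = tgt g;
  gcompA : forall g h k, src g = tgt h -> src h = tgt k ->
    gcomp g (gcomp h k) = gcomp (gcomp g h) k;
  gcomp1g : forall g, gcomp (gunit (tgt g)) g = g;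
  gcompg1 : forall g, gcomp g (gunit (src g)) = g;
  gcompgV : forall g, gcomp g (ginv g) = gunit (tgt g);
  gcompVg : forall g, gcomp (ginv g) g = gunit (src g);
  src_submersion : submersion src;
  tgt_submersion : submersion tgt;
  gunit_smooth : smooth gunit;
  ginv_smooth : smooth ginv;
  gcomp_smooth : @smooth_on R (prod_manifold arrows arrows) arrows
    [set p | src p.1 = tgt p.2] (fun p => gcomp p.1 p.2) }.

Arguments gunit {R X} l _.

Record lieHom (R : realType) (X Y : manifold R) (G : lieGroupoid X)
    (H : lieGroupoid Y) := LieHom {
  hobj : X -> Y;
  harr : arrows G -> arrows H;
  hobj_smooth : smooth hobj;
  harr_smooth : smooth harr;
  harr_src : forall g, src (harr g) = hobj (src g);
  harr_tgt : forall g, tgt (harr g) = hobj (tgt g);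
  harr_unit : forall x, harr (gunit G x) = gunit H (hobj x);
  harr_comp : forall g h, src g = tgt h ->
    harr (gcomp g h) = gcomp (harr g) (harr h) }.

Definition homset (R : realType) (X : manifold R) (G : lieGroupoid X)
  (x y : X) : set (arrows G) := [set g | src g = x /\ tgt g = y].

Arguments homset {R X} G _ _.

Definition fully_faithful (R : realType) (X Y : manifold R)
    (G : lieGroupoid X) (H : lieGroupoid Y) (phi : lieHom G H) : Prop :=
  forall x y,
    set_bij (homset G x y) (homset H (hobj phi x) (hobj phi y)) (harr phi).

Definition lie_isomorphism (R : realType) (X Y : manifold R)
    (G : lieGroupoid X) (H : lieGroupoid Y) (phi : lieHom G H) : Prop :=
  exists psi : lieHom H G,
    [/\ cancel (hobj phi) (hobj psi), cancel (hobj psi) (hobj phi),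
        cancel (harr phi) (harr psi) & cancel (harr psi) (harr phi)].

(* Main.v *)
From HB Require Import structures.
Require Import Defs.
From mathcomp Require Import all_boot all_order all_algebra.
From mathcomp Require Import all_classical all_reals all_analysis.
From mathcomp Require Import ring lra.

(** Why the theorem holds.

    A functor which is fully faithful over the identity of [X] is bijective on
    arrows, and its inverse [psi] is automatically a functor.  So everything
    rests on the smoothness of [psi], which is local on the arrows of [Delta].

    The groupoid structure reduces this to one point in each source fibre.
    If [psi] is smooth near [h1] and [h2] has the same source, put
    [k = h2 h1^-1] and let [tau] be a smooth section of the target map of
    [Gamma] with value [psi k] at [tgt h2].  Near [h2] one has
    [psi h = tau (tgt h) . psi (phi (tau (tgt h))^-1 . h)], and the argument of
    [psi] on the right stays near [h1]; hence [psi] is smooth near [h2]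
    ([inverse_smooth_translate]).

    It remains to find such an [h1] in the source fibre over a given point
    ([inverse_smooth_somewhere_in_fibre]); only the fact that [phi] is a smooth
    bijection commuting with the source submersions is used.  Charts adapted to
    the submersions ([submersion_chart]) turn the fibres into linear subspaces.
    The arrows of [Gamma] are covered by countably many compact sets, on each
    of which the continuous bijection [phi] is a homeomorphism onto its image;
    by the Baire theorem one of the images contains an open piece of the
    fibre, so [psi] is continuous on that piece
    ([continuous_bijection_inverse_somewhere]).
    There [phi] restricts to an injective open smooth map between open sets of
    the coordinate spaces of the fibres, and such a map has a point where its
    Jacobian is invertible ([open_injection_regular_point]): at a point of
    maximal rank the image lies in a graph over as many coordinates as the
    rank, injectivity makes the rank equal to the dimension of the source and
    openness makes it equal to the dimension of the target.  Since [phi]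
    induces the identity transversally to the fibres, its full differential is
    invertible there as well ([bijective_on_kernels]), and the inverse function
    theorem ([inverse_function]) concludes. *)

Set Implicit Arguments. Unset Strict Implicit. Unset Printing Implicit Defensive.
Import Order.TTheory GRing.Theory Num.Theory.
Import numFieldNormedType.Exports.
Local Open Scope classical_set_scope.
Local Open Scope ring_scope.

(** * Functions of class C^k between normed modules *)

Section CkG.
Variable R : realType.

(** The recursion defining [Ck], for maps between arbitrary normed modules:
    the smoothness of determinants and of inverse matrices is then obtained
    entry by entry, from real-valued functions. *)
Fixpoint CkG (V W : normedModType R) (k : nat) (U : set V) (f : V -> W) : Prop :=
  match k with
  | 0 => forall x, U x -> {for x, continuous f}
  | k'.+1 => (forall x, U x -> differentiable f x) /\
             (forall v, CkG k' U (fun x => 'D_v f x))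
  end.

Lemma CkE n m k (U : set 'rV[R]_n) (f : 'rV[R]_n -> 'rV[R]_m) :
  Ck k U f <-> CkG k U f.
Proof.
elim: k f => [//|k IH] f /=; split=> -[h1 h2]; split=> // v; exact/IH.
Qed.

Section general.
Variables (V W : normedModType R).
Implicit Types (U : set V) (f g : V -> W).

(** Being of class C^k involves derivatives at single points only, so it can
    be checked on any family of sets that covers [U]. *)
Lemma CkG_local k U f :
  (forall x, U x -> exists2 A : set V, A x & CkG k A f) -> CkG k U f.
Proof.
elim: k f => [|k IH] f h /=.
  by move=> x /h[A Ax hA]; exact: hA.
split=> [x Ux|v]; first by have [A Ax [hA _]] := h x Ux; exact: hA.
by apply: IH => x /h[A Ax [_ cA]]; exists A => //; exact: cA.
Qed.

Lemma CkG_S k U f : CkG k.+1 U f -> CkG k U f.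
Proof.
elim: k f => [|k IH] f.
  by move=> [h _] x Ux; apply: differentiable_continuous; exact: h.
by move=> [h1 h2]; split=> // v; apply: IH; exact: h2.
Qed.

Lemma CkG_ext k U f g : open U -> (forall x, U x -> f x = g x) ->
  CkG k U f -> CkG k U g.
Proof.
move=> oU; elim: k f g => [|k IH] f g fg /=.
  move=> h x Ux; rewrite /prop_for /continuous_at -(fg x Ux).
  apply: cvg_trans (h x Ux); apply: near_eq_cvg.
  by apply: filterS fg _; exact: open_nbhs_nbhs.
have nfg x : U x -> \near x, f x = g x.
  by move=> Ux; apply: filterS fg _; exact: open_nbhs_nbhs.
move=> [h1 h2]; split=> [x Ux|v].
  by apply: near_differentiable (h1 x Ux); exact: nfg.
apply: IH (h2 v) => x Ux; apply: near_eq_derive; exact: nfg.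
Qed.

Lemma CkG_cst k U (a : W) : CkG k U (fun=> a).
Proof.
elim: k a => [|k IH] a; first by move=> x _; exact: cvg_cst.
split=> [x _|v]; first exact: differentiable_cst.
have -> : 'D_v (fun=> a : W) = (fun=> 0) :> (V -> W); last exact: IH.
by apply/funext => x; exact: derive_cst.
Qed.

Lemma CkG_D k U f g : open U -> CkG k U f -> CkG k U g ->
  CkG k U (fun x => f x + g x).
Proof.
move=> oU; elim: k f g => [|k IH] f g /=.
  by move=> hf hg x Ux; apply: (@continuousD _ _ _ f g); [exact: hf|exact: hg].
move=> [f1 f2] [g1 g2]; split=> [x Ux|v].
  by apply: (@differentiableD _ _ _ f g); [exact: f1|exact: g1].
apply: CkG_ext (IH _ _ (f2 v) (g2 v)) => // x Ux.
by rewrite -(@deriveD _ _ _ f g) //; apply: diff_derivable; [exact: f1|exact: g1].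
Qed.

Lemma CkG_sum k U (I : Type) (r : seq I) (P : pred I) (F : I -> V -> W) : open U ->
  (forall i, P i -> CkG k U (F i)) -> CkG k U (fun x => \sum_(i <- r | P i) F i x).
Proof.
move=> oU h; elim: r => [|i r IH].
  rewrite [X in CkG _ _ X](_ : _ = fun=> 0); first exact: CkG_cst.
  by apply/funext => x; rewrite big_nil.
have [Pi|nPi] := boolP (P i).
  rewrite [X in CkG _ _ X](_ : _ = fun x => F i x + \sum_(j <- r | P j) F j x).
    by apply: CkG_D => //; exact: h.
  by apply/funext => x; rewrite big_cons Pi.
rewrite [X in CkG _ _ X](_ : _ = fun x => \sum_(j <- r | P j) F j x)//.
by apply/funext => x; rewrite big_cons (negbTE nPi).
Qed.

End general.

Lemma CkG_linear (V W W' : normedModType R) k (U : set V) (f : V -> W)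
    (L : {linear W -> W'}) :
  open U -> continuous L -> CkG k U f -> CkG k U (fun x => L (f x)).
Proof.
move=> oU cL; elim: k f => [|k IH] f /=.
  by move=> h x Ux; apply: (@continuous_comp _ _ _ f L); [exact: h|exact: cL].
move=> [h1 h2].
have dL x : differentiable L x by exact: linear_differentiable.
have d1 x : U x -> differentiable (L \o f) x.
  by move=> Ux; apply: differentiable_comp => //; exact: h1.
split=> // v; apply: (@CkG_ext _ _ _ _ (fun x => L ('D_v f x))) => // [x Ux|].
  rewrite (_ : (fun x => L (f x)) = L \o f)// !deriveE; [|exact: d1|exact: h1].
  by rewrite (diff_comp (h1 x Ux) (dL _)) /= diff_lin.
exact: IH (h2 v).
Qed.

Section scalars.
Variable (V : normedModType R).
Implicit Types (U : set V) (f g : V -> R).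

Lemma CkG_M k U f g : open U -> CkG k U f -> CkG k U g ->
  CkG k U (fun x => f x * g x).
Proof.
move=> oU; elim: k f g => [|k IH] f g.
  by move=> hf hg x Ux; apply: (@continuousM _ _ f g); [exact: hf|exact: hg].
move=> cf cg; have [f1 f2] := cf; have [g1 g2] := cg; split=> [x Ux|v].
  by apply: (@differentiableM _ _ f g); [exact: f1|exact: g1].
apply: (@CkG_ext _ _ _ _ (fun x => f x * 'D_v g x + g x * 'D_v f x)) => // [x Ux|].
  rewrite (_ : (fun x => f x * g x) = f * g)// deriveM//; apply: diff_derivable.
    exact: f1.
  exact: g1.
by apply: CkG_D => //; [exact: IH (CkG_S cf) (g2 v)|exact: IH (CkG_S cg) (f2 v)].
Qed.

Lemma CkG_prod k U (I : Type) (r : seq I) (P : pred I) (F : I -> V -> R) : open U ->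
  (forall i, P i -> CkG k U (F i)) -> CkG k U (fun x => \prod_(i <- r | P i) F i x).
Proof.
move=> oU h; elim: r => [|i r IH].
  rewrite [X in CkG _ _ X](_ : _ = fun=> 1); first exact: CkG_cst.
  by apply/funext => x; rewrite big_nil.
have [Pi|nPi] := boolP (P i).
  rewrite [X in CkG _ _ X](_ : _ = fun x => F i x * \prod_(j <- r | P j) F j x).
    by apply: CkG_M => //; exact: h.
  by apply/funext => x; rewrite big_cons Pi.
rewrite [X in CkG _ _ X](_ : _ = fun x => \prod_(j <- r | P j) F j x)//.
by apply/funext => x; rewrite big_cons (negbTE nPi).
Qed.

Lemma CkG_inv k U f : open U -> (forall x, U x -> f x != 0) -> CkG k U f ->
  CkG k U (fun x => (f x)^-1).
Proof.
move=> oU f0; elim: k => [|k IH].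
  by move=> cf x Ux; apply: cvgV; [exact: f0|exact: cf].
move=> cf; have [f1 f2] := cf; split=> [x Ux|v].
  by apply: differentiableV; [exact: f1|exact: f0].
have ci := IH (CkG_S cf).
apply: (@CkG_ext _ _ _ _ (fun x => -1 * ((f x)^-1 * (f x)^-1 * 'D_v f x))) => // [x Ux|].
  rewrite deriveV ?f0//; last by apply: diff_derivable; exact: f1.
  by rewrite mulN1r scaleNr -exprVn expr2.
apply: CkG_M => //; first exact: CkG_cst.
exact: CkG_M oU (CkG_M oU ci ci) (f2 v).
Qed.

End scalars.

End CkG.

(** * Functions of class C^k in coordinates *)

Section rv.
Variable R : realType.

Lemma CkG_linear_fun (V W W' : normedModType R) k (U : set V) (f : V -> W)
    (L : W -> W') : linear L ->
  open U -> continuous L -> CkG k U f -> CkG k U (fun x => L (f x)).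
Proof.
move=> linL.
pose L' : {linear W -> W'} := HB.pack L (GRing.isLinear.Build R W W' *:%R L linL).
exact: (@CkG_linear _ _ _ _ _ _ _ L').
Qed.

Lemma CkG_coord (V : normedModType R) m k (U : set V) (f : V -> 'rV[R]_m) j :
  open U -> CkG k U f -> CkG k U (fun x => f x 0 j).
Proof.
move=> oU; apply: (@CkG_linear_fun _ _ _ _ _ _ (fun y : 'rV[R]_m => y 0 j)) => //.
  by move=> a x y; rewrite !mxE.
by move=> x; exact: coord_continuous.
Qed.

Lemma CkG_row (V : normedModType R) m k (U : set V) (f : V -> 'rV[R]_m) :
  open U -> (forall j, CkG k U (fun x => f x 0 j)) -> CkG k U f.
Proof.
move=> oU cf; apply: (@CkG_ext _ _ _ _ _ (fun x => \sum_j (f x 0 j *: delta_mx 0 j))) => //.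
  by move=> x Ux; rewrite -row_sum_delta.
apply: CkG_sum => // j _.
apply: (@CkG_linear_fun _ _ _ _ _ _ (fun y : R => y *: (delta_mx 0 j : 'rV[R]_m))) => //.
  by move=> a x y; rewrite scalerDl scalerA.
by move=> x; exact: scalel_continuous.
Qed.

Lemma derive_sum_coord (W : normedModType R) m (g : 'rV[R]_m -> W) (y v : 'rV[R]_m) :
  differentiable g y -> 'D_v g y = \sum_j (v 0 j *: 'D_(delta_mx 0 j) g y).
Proof.
move=> dg; rewrite deriveE// {1}[v]row_sum_delta linear_sum; apply: eq_bigr => j _.
by rewrite linearZ /= deriveE.
Qed.

(** The chain rule writes the directional derivative of the composite as a
    sum of products of derivatives of [f] with composites of partial
    derivatives of [g] with [f], which are covered by the induction
    hypothesis. Real-valued [g] suffices, the general case following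
    coordinatewise. *)
Lemma CkG_comp_scalar n m k (U : set 'rV[R]_n) (V : set 'rV[R]_m)
    (f : 'rV[R]_n -> 'rV[R]_m) (g : 'rV[R]_m -> R) : open U -> open V ->
  (forall x, U x -> V (f x)) -> CkG k U f -> CkG k V g ->
  CkG k U (fun x => g (f x)).
Proof.
move=> oU oV UV; elim: k g => [|k IH] g cf cg.
  move=> x Ux; apply: (@continuous_comp _ _ _ f g); first exact: cf.
  by apply: cg; exact: UV.
have [f1 f2] := cf; have [g1 g2] := cg; split=> [x Ux|v].
  by apply: (@differentiable_comp _ _ _ _ f g); [exact: f1|apply: g1; exact: UV].
apply: (@CkG_ext _ _ _ _ _
    (fun x => \sum_j ('D_v f x 0 j * 'D_(delta_mx 0 j) g (f x)))) => // [x Ux|].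
  have dgf : differentiable g (f x) by apply: g1; exact: UV.
  rewrite -(derive_sum_coord ('D_v f x) dgf).
  rewrite (_ : (fun x => g (f x)) = g \o f)//.
  rewrite (deriveE _ (differentiable_comp (f1 x Ux) dgf)) (deriveE _ dgf) (deriveE _ (f1 x Ux)).
  by rewrite (diff_comp (f1 x Ux) dgf).
apply: CkG_sum => // j _; apply: CkG_M => //.
  by apply: CkG_coord => //; exact: f2.
exact: IH (CkG_S cf) (g2 _).
Qed.

Lemma Cinf_row n m (U : set 'rV[R]_n) (f : 'rV[R]_n -> 'rV[R]_m) :
  open U -> Cinf U f <-> forall j k, CkG k U (fun x => f x 0 j).
Proof.
move=> oU; split=> [cf j k|cf k]; first by apply: CkG_coord => //; apply/CkE; exact: cf.
by apply/CkE; apply: CkG_row.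
Qed.

Lemma Cinf_sub n m (U A : set 'rV[R]_n) (f : 'rV[R]_n -> 'rV[R]_m) :
  U `<=` A -> Cinf A f -> Cinf U f.
Proof. by move=> UA cf k; apply: Ck_sub (cf k). Qed.

Lemma Cinf_ext n m (U : set 'rV[R]_n) (f g : 'rV[R]_n -> 'rV[R]_m) :
  open U -> (forall x, U x -> f x = g x) -> Cinf U f -> Cinf U g.
Proof. by move=> oU fg cf k; apply: Ck_ext (cf k). Qed.

Lemma Cinf_local n m (U : set 'rV[R]_n) (f : 'rV[R]_n -> 'rV[R]_m) :
  (forall x, U x -> exists2 A : set _, A x & Cinf A f) -> Cinf U f.
Proof.
move=> h k; apply/CkE; apply: CkG_local => x /h[A Ax cA]; exists A => //.
by apply/CkE; exact: cA.
Qed.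

Lemma Cinf_comp n m p (U : set 'rV[R]_n) (V : set 'rV[R]_m)
    (f : 'rV[R]_n -> 'rV[R]_m) (g : 'rV[R]_m -> 'rV[R]_p) : open U -> open V ->
  (forall x, U x -> V (f x)) -> Cinf U f -> Cinf V g -> Cinf U (g \o f).
Proof.
move=> oU oV UV cf cg; apply/Cinf_row => // j k.
apply: (@CkG_comp_scalar _ _ _ U V f (fun y => g y 0 j)) => //.
  by apply/CkE; exact: cf.
by move/Cinf_row: cg; apply.
Qed.

Lemma Cinf_D n m (U : set 'rV[R]_n) (f g : 'rV[R]_n -> 'rV[R]_m) :
  open U -> Cinf U f -> Cinf U g -> Cinf U (fun x => f x + g x).
Proof. by move=> oU cf cg k; apply: CkD. Qed.

Lemma Cinf_cst n m (U : set 'rV[R]_n) (a : 'rV[R]_m) : Cinf U (fun=> a).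
Proof. by move=> k; apply/CkE; exact: CkG_cst. Qed.

Lemma Cinf_id n (U : set 'rV[R]_n) : Cinf U id.
Proof.
case=> [|k]; first by move=> x _; exact: cvg_id.
split=> [x _|v].
  have cid : continuous (idfun : {linear 'rV[R]_n -> 'rV[R]_n}).
    by move=> y; exact: cvg_id.
  exact: (linear_differentiable x cid).
have -> : 'D_v (@id 'rV[R]_n) = (fun=> v) by apply/funext => x; exact: derive_id.
by apply/CkE; exact: CkG_cst.
Qed.

Lemma Cinf_mulmx n m p (U : set 'rV[R]_n) (f : 'rV[R]_n -> 'rV[R]_m) (A : 'M[R]_(m, p)) :
  open U -> Cinf U f -> Cinf U (fun x => f x *m A).
Proof.
move=> oU cf k; apply/CkE.
apply: (@CkG_linear _ _ _ _ _ _ _ (mulmxr A : {linear 'rV[R]_m -> 'rV[R]_p})) => //.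
  by move=> x; exact: linear_rV_continuous.
by apply/CkE; exact: cf.
Qed.

Lemma Cinf_continuous n m (U : set 'rV[R]_n) (f : 'rV[R]_n -> 'rV[R]_m) x :
  Cinf U f -> U x -> {for x, continuous f}.
Proof. by move=> cf Ux; exact: (cf 0 x Ux). Qed.

Lemma Cinf_differentiable n m (U : set 'rV[R]_n) (f : 'rV[R]_n -> 'rV[R]_m) x :
  Cinf U f -> U x -> differentiable f x.
Proof. by move=> cf Ux; have [+ _] := cf 1%N; exact. Qed.

End rv.

(** * Mean value estimates and perturbations of the identity *)

HB.instance Definition _ (R : realType) n := Complete.on 'rV[R]_n.

Section mvt.
Variable R : realType.

Lemma coord_norm_le n (v : 'rV[R]_n) j : `|v 0 j| <= `|v|.
Proof.
rewrite {2}/Num.norm /= mx_normrE; exact: (le_bigmax _ (fun ij => `|v ij.1 ij.2|) (0, j)).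
Qed.

Lemma norm_le_coord n (v : 'rV[R]_n) e : 0 <= e ->
  (forall j, `|v 0 j| <= e) -> `|v| <= e.
Proof.
move=> e0 h; rewrite {1}/Num.norm /= mx_normrE.
by apply: bigmax_le => // -[i j] _ /=; rewrite ord1.
Qed.

(** The mean value theorem fails for vector-valued functions, but it holds
    for each coordinate, with an intermediate point depending on the
    coordinate. *)
Lemma mvt_coord n m (f : 'rV[R]_n -> 'rV[R]_m) (x v : 'rV[R]_n) j :
  (forall t : R, 0 <= t <= 1 -> differentiable f (x + t *: v)) ->
  exists2 t : R, 0 <= t <= 1 & (f (x + v) - f x) 0 j = 'D_v f (x + t *: v) 0 j.
Proof.
move=> df; pose h (t : R) := f (x + t *: v).
have quot t : (fun s : R => s^-1 *: (h (s *: 1 + t) - h t)) =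
              (fun s => s^-1 *: (f (s *: v + (x + t *: v)) - f (x + t *: v))).
  apply/funext => s; rewrite /h; congr (_ *: (f _ - _)).
  by rewrite [s *: 1]mulr1 scalerDl addrCA.
have dh t : 0 <= t <= 1 -> derivable h t 1.
  move=> t01; rewrite /derivable quot; apply: diff_derivable; exact: df.
have Dh t : 'D_1 h t = 'D_v f (x + t *: v) by rewrite /derive quot.
pose hj t := h t 0 j.
have dhj t : 0 <= t <= 1 -> derivable hj t 1.
  by move=> /dh/derivable_mxP; exact.
have Dhj t : 0 <= t <= 1 -> 'D_1 hj t = 'D_v f (x + t *: v) 0 j.
  by move=> /dh /derive_mx; rewrite -Dh => ->; rewrite mxE.
have [|||t t01] := @MVT_segment R hj (fun t => 'D_1 hj t) 0 1.
- exact: ler01.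
- move=> t; rewrite in_itv /= => /andP[t0 t1]; apply: derivableP.
  by apply: dhj; rewrite !ltW.
- by apply: derivable_within_continuous => t; rewrite in_itv /=; exact: dhj.
rewrite in_itv /= in t01; rewrite Dhj // subr0 mulr1 /hj /h scale1r scale0r addr0 => e.
by exists t => //; rewrite -e !mxE.
Qed.

Lemma ball_convex n (c x y : 'rV[R]_n) r (t : R) : ball c r x -> ball c r y ->
  0 <= t <= 1 -> ball c r (x + t *: (y - x)).
Proof.
rewrite -ball_normE /= => cx cy /andP[t0 t1].
have -> : c - (x + t *: (y - x)) = (1 - t) *: (c - x) + t *: (c - y).
  by apply/rowP => i; rewrite !mxE; ring.
have [->|tn0] := eqVneq t 0; first by rewrite subr0 scale1r scale0r addr0.
apply: le_lt_trans (ler_normD _ _) _; rewrite !normrZ.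
have -> : r = (1 - t) * r + t * r by rewrite -mulrDl subrK mul1r.
rewrite ger0_norm ?subr_ge0// (ger0_norm t0); apply: ler_ltD.
  by apply: ler_wpM2l (ltW cx); rewrite subr_ge0.
by rewrite ltr_pM2l // lt_neqAle eq_sym tn0.
Qed.

Lemma lipschitz_ball n m (u : 'rV[R]_n -> 'rV[R]_m) c r (k : R) : 0 <= k ->
  (forall z, ball c r z -> differentiable u z) ->
  (forall z i j, ball c r z -> `|'D_(delta_mx 0 i) u z 0 j| <= k) ->
  forall x y, ball c r x -> ball c r y -> `|u y - u x| <= n%:R * k * `|y - x|.
Proof.
move=> k0 du hk x y cx cy; apply: norm_le_coord => [|j].
  by rewrite mulr_ge0// mulr_ge0.
have bt t : 0 <= t <= 1 -> ball c r (x + t *: (y - x)) by exact: ball_convex.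
have [|t /bt ct] := @mvt_coord n m u x (y - x) j; first by move=> t /bt; exact: du.
rewrite (addrC x) subrK => ->; rewrite derive_sum_coord; last exact: du.
rewrite summxE; apply: le_trans (ler_norm_sum _ _ _) _.
apply: (@le_trans _ _ (\sum_(i < n) k * `|y - x|)).
  apply: ler_sum => i _; rewrite mxE normrM mulrC.
  by apply: ler_pM => //; [exact: hk|exact: coord_norm_le].
by rewrite sumr_const card_ord -[leLHS]mulr_natl mulrA.
Qed.

Section near_identity.
Variables (n : nat) (f : 'rV[R]_n -> 'rV[R]_n) (c : 'rV[R]_n) (r : R).
Hypothesis contr : forall x y, ball c r x -> ball c r y ->
  `|(y - f y) - (x - f x)| <= 2^-1 * `|y - x|.

Lemma near_identity_expand x y : ball c r x -> ball c r y ->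
  `|y - x| <= 2 * `|f y - f x|.
Proof.
move=> Bx By; have := contr Bx By.
have := ler_normD ((y - f y) - (x - f x)) (f y - f x).
rewrite (_ : _ + (f y - f x) = y - x); last by apply/rowP => i; rewrite !mxE; ring.
move=> h1 h2; lra.
Qed.

(** A preimage of [y] is a fixed point of the contraction [z |-> z - f z +
    y], which preserves a small closed ball around [x] when [y] is close
    enough to [f x]. *)
Lemma near_identity_open x : ball c r x -> nbhs (f x) (f @` ball c r).
Proof.
move=> Bx; have : nbhs x (ball c r) by apply: open_nbhs_nbhs; split=> //; exact: ball_open.
move=> /nbhs_closedballP[d]; rewrite closed_ballE // => sub.
have d0 : 0 < d%:num / 2 by rewrite divr_gt0.
apply/nbhs_ballP; exists (d%:num / 2) => // y; rewrite -ball_normE /= => fxy.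
set K := closed_ball_ _ _ _ in sub.
pose T z := z - f z + y.
have Kx : K x by rewrite /K /closed_ball_ /= subrr normr0.
have TK : set_fun K K T.
  move=> z Kz; have := contr Bx (sub _ Kz); move: Kz; rewrite /K /closed_ball_ /= => Kz.
  rewrite (distrC z x) => hz; rewrite /T distrC.
  have -> : z - f z + y - x = (z - f z - (x - f x)) - (f x - y).
    by apply/rowP => i; rewrite !mxE; ring.
  apply: le_trans (ler_normB _ _) _.
  lra.
pose T' : {fun K >-> K} := HB.pack T (isFun.Build _ _ K K T TK).
have cT : is_contraction T'.
  exists (2^-1)%:nng; split=> /=; first by rewrite invf_lt1 // ltr1n.
  move=> [z w] /= [Kz Kw]; rewrite /T.
  rewrite (_ : _ - _ = (z - f z) - (w - f w)); last by apply/rowP => i; rewrite !mxE; ring.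
  by apply: contr; exact: sub.
have [||z Kz Tz] := banach_fixed_point cT.
- rewrite /K -closed_ballE //; exact: closed_ball_closed.
- by exists x.
exists z; first by have := sub _ Kz; rewrite -ball_normE.
have {}Tz : z = z - f z + y by exact: Tz.
rewrite (_ : f z = (z - (z - f z + y)) + y); first by rewrite -Tz subrr add0r.
by apply/rowP => i; rewrite !mxE; ring.
Qed.

End near_identity.

(** Writing [k = g (y0 + h) - g y0], the expansion of [f] at [g y0] gives [h
    = k J + o(k)]; the Lipschitz bound turns [o(k)] into [o(h)], and applying
    the inverse of [J] yields the expansion of [g]. *)
Lemma differentiable_inverse n (f g : 'rV[R]_n -> 'rV[R]_n) (y0 : 'rV[R]_n) :
  (\forall y \near y0, f (g y) = y) ->
  (\forall y \near y0, `|g y - g y0| <= 2 * `|y - y0|) ->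
  differentiable f (g y0) -> jacobian f (g y0) \in unitmx ->
  differentiable g y0 /\ forall v, 'D_v g y0 = v *m invmx (jacobian f (g y0)).
Proof.
move=> fg lg df uJ; set J := jacobian f (g y0).
pose L : {linear 'rV[R]_n -> 'rV[R]_n} := mulmxr (invmx J).
have cL : continuous L by exact: linear_rV_continuous.
have expand : g \o shift y0 = cst (g y0) + L +o_ 0 id.
  apply/eqaddoP => e e0.
  have [C C0 hC] := linear_lipschitz cL.
  have /diff_locallyP[_ /eqaddoP /(_ (e / (2 * C)))] := df.
  have e20 : 0 < e / (2 * C) by rewrite divr_gt0 // mulr_gt0.
  move=> /(_ e20) /nbhs_ballP[d /= d0 hd].
  have n1 : \forall h \near (0 : 'rV[R]_n), `|h| < d / 2.
    apply/nbhs_ballP; exists (d / 2) => /=; first by rewrite divr_gt0.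
    by move=> h; rewrite -ball_normE /= sub0r normrN.
  have n2 : \forall h \near (0 : 'rV[R]_n), f (g (h + y0)) = h + y0.
    have := fg; rewrite (near_shift 0) /=.
    by apply: filterS => h; rewrite /= subr0.
  have n3 : \forall h \near (0 : 'rV[R]_n), `|g (h + y0) - g y0| <= 2 * `|h|.
    have := lg; rewrite (near_shift 0) /=.
    by apply: filterS => h; rewrite /= subr0 addrK.
  have fgy0 := nbhs_singleton fg.
  apply: filterS3 n1 n2 n3 => h h1 h2 h3; rewrite !fctE /=.
  set k := g (h + y0) - g y0 in h3.
  have /hd : ball (0 : 'rV[R]_n) d k.
    by rewrite -ball_normE /= sub0r normrN; lra.
  rewrite !fctE /= /k subrK h2 fgy0 -/k => hk.
  have -> : g (h + y0) - (g y0 + h *m invmx J) = - L (h + y0 - (y0 + 'd f (g y0) k)).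
    have -> : 'd f (g y0) k = k *m J by rewrite /J /jacobian mul_rV_lin1.
    rewrite /L /= (_ : h + y0 - _ = h - k *m J); last by rewrite opprD addrA addrK.
    by rewrite mulmxBl mulmxK // opprB /k opprD addrA.
  rewrite normrN; apply: le_trans (hC _) _.
  apply: (@le_trans _ _ (C * (e / (2 * C) * (2 * `|h|)))).
    apply: ler_wpM2l; first exact: ltW.
    by apply: le_trans hk _; apply: ler_wpM2l => //; exact: ltW.
  by rewrite (_ : C * _ = e * `|h|) //; field; rewrite gt_eqF.
have dg := @diff_unique _ _ _ g L y0 cL expand.
have dfg : differentiable g y0 by apply/diff_locallyP; rewrite dg.
by split=> // v; rewrite deriveE // dg.
Qed.

End mvt.

(** * The inverse function theorem *)

Section ift.
Variable R : realType.

Lemma CkG_det (V : normedModType R) k (U : set V) n (A : V -> 'M[R]_n) :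
  open U -> (forall i j, CkG k U (fun x => A x i j)) -> CkG k U (fun x => \det (A x)).
Proof.
move=> oU cA; apply: CkG_sum => // s _; apply: CkG_M => //; first exact: CkG_cst.
by apply: CkG_prod.
Qed.

(** Cramer's formula makes the entries of the inverse matrix rational
    functions of the entries of the matrix. *)
Lemma CkG_invmx (V : normedModType R) k (U : set V) n (A : V -> 'M[R]_n) i j :
  open U -> (forall x, U x -> A x \in unitmx) ->
  (forall i j, CkG k U (fun x => A x i j)) -> CkG k U (fun x => invmx (A x) i j).
Proof.
move=> oU uA cA.
apply: (@CkG_ext _ _ _ _ _ (fun x => (\det (A x))^-1 * \adj (A x) i j)) => //.
  by move=> x /uA ux; rewrite /invmx ux [RHS]mxE.
apply: CkG_M => //.
  apply: CkG_inv => //; last exact: CkG_det.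
  by move=> x /uA; rewrite unitmxE unitfE.
rewrite (_ : (fun x => _) = (fun x => (-1) ^+ (j + i) * \det (row' j (col' i (A x))))).
  apply: CkG_M => //; first exact: CkG_cst.
  apply: CkG_det => // a b.
  rewrite (_ : (fun x => _) = (fun x => A x (lift j a) (lift i b)))//.
  by apply/funext => x; rewrite !mxE.
by apply/funext => x; rewrite mxE.
Qed.

Lemma jacobianE n m (f : 'rV[R]_n -> 'rV[R]_m) x i j :
  differentiable f x -> jacobian f x i j = 'D_(delta_mx 0 i) f x 0 j.
Proof. by move=> df; rewrite deriveEjacobian// -rowE [RHS]mxE. Qed.

Lemma Cinf_derive n m (U : set 'rV[R]_n) (f : 'rV[R]_n -> 'rV[R]_m) v :
  Cinf U f -> Cinf U ('D_v f).
Proof. by move=> cf k; have [_] := cf k.+1; exact. Qed.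

(** Near [x0] the map [id - f] is a contraction of ratio 1/2, so [f] is
    injective and open there and its inverse is Lipschitz, hence
    differentiable. The derivative of the inverse is the inverse Jacobian of
    [f] composed with the inverse; this formula raises the order of
    differentiability of the inverse by one, and induction gives all orders. *)
Lemma inverse_function_id n (U : set 'rV[R]_n) (f : 'rV[R]_n -> 'rV[R]_n) x0 :
  open U -> U x0 -> Cinf U f -> jacobian f x0 = 1%:M ->
  exists (V : set 'rV[R]_n) (g : 'rV[R]_n -> 'rV[R]_n),
    [/\ open V, V x0, V `<=` U, open (f @` V) &
        (forall x, V x -> g (f x) = x) /\ Cinf (f @` V) g].
Proof.
move=> oU Ux0 cf Jx0; pose u x := x - f x.
have df x : U x -> differentiable f x by move=> Ux; exact: Cinf_differentiable cf Ux.
have cu : Cinf U u.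
  rewrite (_ : u = (fun x => x + f x *m (- 1%:M))).
    apply: Cinf_D => //; first exact: Cinf_id.
    exact: Cinf_mulmx.
  by apply/funext => x; rewrite mulmxN mulmx1.
have du x : U x -> differentiable u x by move=> Ux; exact: Cinf_differentiable cu Ux.
have Du x v : U x -> 'D_v u x = v - 'D_v f x.
  move=> Ux; rewrite (_ : u = id - f)// deriveB ?derive_id//.
  by apply: diff_derivable; exact: df.
(* A bound k on the n^2 entries of the Jacobian of [u] bounds its operator norm
   by n k, which is at most 1/2. *)
pose k : R := (2 * n.+1%:R)^-1.
have k0 : 0 < k by rewrite invr_gt0 mulr_gt0.
have nk : n%:R * k <= 2^-1.
  rewrite /k invfM mulrCA ler_piMr// ler_pdivrMr// mul1r ler_nat.
  exact: leqnSn.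
have nearB : \forall z \near x0, forall (i j : 'I_n), `|'D_(delta_mx 0 i) u z 0 j| <= k.
  pose P (i j : 'I_n) (z : 'rV[R]_n) := `|'D_(delta_mx 0 i) u z 0 j| <= k.
  suff Pij i j : nbhs x0 (P i j).
    refine (@filter_forall _ 'I_n (fun i z => forall j, P i j z) _ (nbhs_filter x0) _) => i.
    exact: (@filter_forall _ 'I_n (P i) _ (nbhs_filter x0) (Pij i)).
  have ci : {for x0, continuous ('D_(delta_mx 0 i) u)}.
    by apply: Cinf_continuous Ux0; exact: Cinf_derive.
  have cij : {for x0, continuous (fun z => 'D_(delta_mx 0 i) u z 0 j)}.
    apply: (@continuous_comp _ _ _ ('D_(delta_mx 0 i) u) (fun y : 'rV[R]_n => y 0 j)) => //.
    exact: coord_continuous.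
  have zij : 'D_(delta_mx 0 i) u x0 0 j = 0.
    by rewrite Du// deriveEjacobian ?Jx0 ?mulmx1 ?subrr ?mxE//; exact: df.
  move/cvgrPdist_le : cij => /(_ k k0); apply: filterS => z.
  by rewrite zij sub0r normrN.
have : nbhs x0 (U `&` [set z | forall i j, `|'D_(delta_mx 0 i) u z 0 j| <= k]).
  by apply: filterI => //; exact: open_nbhs_nbhs.
move=> /nbhs_ballP[r /= r0 sub].
have contr x y : ball x0 r x -> ball x0 r y -> `|(y - f y) - (x - f x)| <= 2^-1 * `|y - x|.
  move=> Bx By; apply: (@le_trans _ _ (n%:R * k * `|y - x|)); last exact: ler_wpM2r.
  apply: (@lipschitz_ball _ _ _ u x0 r k (ltW k0)) => //.
    by move=> z /sub[Uz _]; exact: du.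
  by move=> z i j /sub[_]; exact.
have expand := near_identity_expand contr.
have oV : open (f @` ball x0 r).
  rewrite openE => _ [x Bx <-]; exact: near_identity_open.
have inj x y : ball x0 r x -> ball x0 r y -> f x = f y -> x = y.
  move=> Bx By fxy; have := expand x y Bx By; rewrite fxy subrr normr0 mulr0 normr_le0.
  by rewrite subr_eq0 => /eqP.
pose g y := xget x0 [set x | ball x0 r x /\ f x = y].
have gP y : (f @` ball x0 r) y -> ball x0 r (g y) /\ f (g y) = y.
  by move=> [x Bx fx]; apply: (@xgetPex _ x0 [set x | ball x0 r x /\ f x = y]); exists x.
have gK x : ball x0 r x -> g (f x) = x.
  move=> Bx; have [|Bg fg] := gP (f x); first by exists x.
  exact: inj.
(* A vector killed by the Jacobian of [f] would be fixed by that of [u], whose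
   norm is at most 1/2. *)
have uJ x : ball x0 r x -> jacobian f x \in unitmx.
  move=> Bx; have [Ux hx] := sub _ Bx.
  rewrite -row_free_unit; apply: inj_row_free => v; rewrite -deriveEjacobian; last exact: df.
  move=> vJ; have Dv : 'D_v u x = v by rewrite Du// vJ subr0.
  have : `|v| <= n%:R * k * `|v|.
    rewrite -{1}Dv; apply: norm_le_coord => [|j].
      by rewrite mulr_ge0// mulr_ge0// ltW.
    rewrite derive_sum_coord; last exact: du.
    rewrite summxE; apply: le_trans (ler_norm_sum _ _ _) _.
    apply: (@le_trans _ _ (\sum_(i < n) k * `|v|)).
      apply: ler_sum => i _; rewrite mxE normrM mulrC.
      by apply: ler_pM => //; exact: coord_norm_le.
    by rewrite sumr_const card_ord -[leLHS]mulr_natl mulrA.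
  have : n%:R * k * `|v| <= 2^-1 * `|v| by exact: ler_wpM2r.
  have := normr_ge0 v => h1 h2 h3.
  by apply/eqP; rewrite -normr_le0; lra.
have gdiff y : (f @` ball x0 r) y -> differentiable g y /\
    forall v, 'D_v g y = v *m invmx (jacobian f (g y)).
  move=> Vy; have [Bg fg] := gP y Vy.
  have nV : nbhs y (f @` ball x0 r) by exact: open_nbhs_nbhs.
  apply: differentiable_inverse.
  - by apply: filterS nV => z /gP[].
  - apply: filterS nV => z /gP[Bz fz].
    by have := expand _ _ Bg Bz; rewrite fg fz.
  - by apply: df; have [] := sub _ Bg.
  - exact: uJ.
exists (ball x0 r), g; split => //.
- exact: ball_open.
- exact: ballxx.
- by move=> x /sub[].
split=> // m; apply/CkE; elim: m => [|m IH].
  by move=> y /gdiff[dg _]; exact: differentiable_continuous.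
split=> [y /gdiff[]//|v].
pose J y := jacobian f (g y).
apply: (@CkG_ext _ _ _ _ _ (fun y => v *m invmx (J y))) => //.
  by move=> y /gdiff[_ ->].
apply: CkG_row => // j.
rewrite (_ : (fun y => _) = (fun y => \sum_i v 0 i * invmx (J y) i j)); last first.
  by apply/funext => y; rewrite mxE.
apply: CkG_sum => // i _; apply: CkG_M => //; first exact: CkG_cst.
apply: CkG_invmx => //; first by move=> y /gP[Bg _]; exact: uJ.
move=> a b; apply: (@CkG_ext _ _ _ _ _ (fun y => 'D_(delta_mx 0 a) f (g y) 0 b)) => //.
  by move=> y /gP[Bg _]; rewrite /J jacobianE//; apply: df; have [] := sub _ Bg.
apply: (@CkG_comp_scalar _ _ _ _ _ U g (fun x => 'D_(delta_mx 0 a) f x 0 b)) => //.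
  by move=> y /gP[Bg _]; have [] := sub _ Bg.
by move/Cinf_row: (Cinf_derive (delta_mx 0 a) cf); apply.
Qed.
End ift.

(** * Jacobians, straightening and the rank of an open injection *)

Section rank.
Variable R : realType.

Lemma jacobian_unique n m (f : 'rV[R]_n -> 'rV[R]_m) x (A : 'M[R]_(n, m)) :
  differentiable f x -> (forall v, 'D_v f x = v *m A) -> jacobian f x = A.
Proof.
by move=> df h; apply/row_matrixP => i; rewrite !rowE -deriveEjacobian.
Qed.

Lemma jacobian_comp n m p (f : 'rV[R]_n -> 'rV[R]_m) (g : 'rV[R]_m -> 'rV[R]_p) x :
  differentiable f x -> differentiable g (f x) ->
  jacobian (g \o f) x = jacobian f x *m jacobian g (f x).
Proof.
move=> df dg; have dgf := differentiable_comp df dg.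
apply: jacobian_unique => // v.
rewrite mulmxA -!deriveEjacobian// (deriveE _ dgf) (deriveE _ dg) (deriveE _ df).
by rewrite (diff_comp df dg).
Qed.

Lemma jacobian_near n m (f g : 'rV[R]_n -> 'rV[R]_m) x :
  (\forall y \near x, f y = g y) -> differentiable f x -> jacobian g x = jacobian f x.
Proof.
move=> fg df; have dg := near_differentiable fg df.
apply: jacobian_unique => // v; rewrite -deriveEjacobian//.
by apply/esym; exact: near_eq_derive.
Qed.

Lemma differentiable_affine n m (a : 'rV[R]_m) (A : 'M[R]_(n, m)) x :
  differentiable (fun y : 'rV[R]_n => a + y *m A) x /\
  jacobian (fun y : 'rV[R]_n => a + y *m A) x = A.
Proof.
pose L : {linear 'rV[R]_n -> 'rV[R]_m} := mulmxr A.
have cL : continuous L by exact: linear_rV_continuous.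
have dL : differentiable L x by exact: linear_differentiable.
have da : differentiable (cst a : 'rV[R]_n -> _) x by exact: differentiable_cst.
have d1 : differentiable (cst a + L) x by exact: differentiableD.
split; first exact: d1.
apply: jacobian_unique => // v.
rewrite (_ : (fun _ => _) = cst a + L)// deriveD; [|exact: diff_derivable..].
by rewrite derive_cst add0r deriveE// diff_lin.
Qed.

Lemma jacobian_affine n m p (f : 'rV[R]_n -> 'rV[R]_m) (a : 'rV[R]_p) A x :
  differentiable f x ->
  differentiable (fun y => a + f y *m A) x /\
  jacobian (fun y => a + f y *m A) x = jacobian f x *m A.
Proof.
move=> df; have [dA jA] := differentiable_affine a A (f x); split.
  by apply: (@differentiable_comp _ _ _ _ f (fun y => a + y *m A)).
by rewrite -{2}jA -(jacobian_comp df dA).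
Qed.

Lemma differentiable_idmap n (x : 'rV[R]_n) : differentiable (@id 'rV[R]_n) x.
Proof. exact: Cinf_differentiable (Cinf_id (setT : set 'rV[R]_n)) I. Qed.

Lemma jacobian_id n (x : 'rV[R]_n) : jacobian id x = 1%:M.
Proof.
apply: jacobian_unique; first exact: differentiable_idmap.
by move=> v; rewrite derive_id mulmx1.
Qed.

Lemma open_mulmx_preimage n m (A : 'M[R]_(n, m)) (U : set 'rV[R]_m) :
  open U -> open ((fun y : 'rV[R]_n => y *m A) @^-1` U).
Proof.
move=> oU; apply: open_comp => // x _.
exact: (@linear_rV_continuous _ _ _ (mulmxr A)).
Qed.

(** Composing with the inverse of the Jacobian reduces to the case of
    identity Jacobian. Invertibility of the Jacobian is expressed by its
    rank, so that the dimensions of the source and the target need not be the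
    same term. *)
Lemma inverse_function n m (U : set 'rV[R]_n) (f : 'rV[R]_n -> 'rV[R]_m) x0 :
  open U -> U x0 -> Cinf U f ->
  row_free (jacobian f x0) -> row_full (jacobian f x0) ->
  exists (V : set 'rV[R]_n) (g : 'rV[R]_m -> 'rV[R]_n),
    [/\ open V, V x0, V `<=` U, open (f @` V) &
        (forall x, V x -> g (f x) = x) /\ Cinf (f @` V) g].
Proof.
move=> oU Ux0 cf Jfree Jfull; set J := jacobian f x0.
pose J' := pinvmx J.
have JJ' : J *m J' = 1%:M by exact: mulmxVp.
have J'J : J' *m J = 1%:M by exact: mulVpmx.
pose F x := 0 + f x *m J'.
have cF : Cinf U F by apply: Cinf_D => //; [exact: Cinf_cst|exact: Cinf_mulmx].
have JF : jacobian F x0 = 1%:M.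
  have [_ ->] := jacobian_affine 0 J' (Cinf_differentiable cf Ux0); exact: JJ'.
have [V [G [oV Vx0 VU oFV [GK cG]]]] := inverse_function_id oU Ux0 cF JF.
have fVE : f @` V = (fun y => y *m J') @^-1` (F @` V).
  apply/seteqP; split=> [_ [x Vx <-]|y [x Vx]] /=.
    by exists x => //; rewrite /F add0r.
  rewrite /F add0r => e; exists x => //.
  by have := congr1 (mulmx^~ J) e; rewrite /= -(mulmxA (f x)) -(mulmxA y) J'J !mulmx1.
have ofV : open (f @` V) by rewrite fVE; exact: open_mulmx_preimage.
exists V, (G \o (fun y => y *m J')); split=> //; split.
  by move=> x Vx /=; rewrite -[_ *m _]add0r; exact: GK.
apply: (@Cinf_comp _ _ _ _ _ (F @` V)) => //.
  by rewrite fVE.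
by apply: Cinf_mulmx => //; exact: Cinf_id.
Qed.

(** With [Q] a right inverse of the differential, the coordinates [E x = (x -
    x0) (1 - J Q) + (f x - f x0) Q] have identity Jacobian at [x0], and [E x
    J = f x - f x0] because [Q J = 1]. Staying in the source dimension avoids
    splitting it as a sum. *)
Lemma straighten n m (U : set 'rV[R]_n) (f : 'rV[R]_n -> 'rV[R]_m) x0 :
  open U -> U x0 -> Cinf U f -> row_full (jacobian f x0) ->
  exists (V : set 'rV[R]_n) (E E' : 'rV[R]_n -> 'rV[R]_n),
    [/\ [/\ open V, V x0 & V `<=` U],
        [/\ Cinf V E, open (E @` V) & Cinf (E @` V) E'],
        E x0 = 0, (forall x, V x -> E' (E x) = x) &
        forall x, V x -> f x = f x0 + E x *m jacobian f x0].
Proof.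
move=> oU Ux0 cf Jfull; set J := jacobian f x0.
pose Q := pinvmx J; have QJ : Q *m J = 1%:M by exact: mulVpmx.
pose F x := f x - f x0; pose E x := (x - x0) *m (1%:M - J *m Q) + F x *m Q.
have cF : Cinf U F by apply: Cinf_D => //; exact: Cinf_cst.
have cid : Cinf U (fun x => x - x0) by apply: Cinf_D => //; [exact: Cinf_id|exact: Cinf_cst].
have cE : Cinf U E by apply: Cinf_D => //; exact: Cinf_mulmx.
have df := Cinf_differentiable cf Ux0.
have JE : jacobian E x0 = 1%:M.
  have [d1 j1] := differentiable_affine (- (x0 *m (1%:M - J *m Q))) (1%:M - J *m Q) x0.
  have [d2 j2] := jacobian_affine (- (f x0 *m Q)) Q df.
  have -> : E = (fun y => - (x0 *m (1%:M - J *m Q)) + y *m (1%:M - J *m Q)) +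
             (fun y => - (f x0 *m Q) + f y *m Q).
    apply/funext => y; rewrite /E /F !fctE !mulmxBl.
    by rewrite [in RHS]addrC [in RHS](addrC (- _)) addrC [in RHS](addrC (- _)).
  apply: jacobian_unique; first exact: differentiableD.
  move=> v; rewrite deriveD; [|exact: diff_derivable..].
  rewrite (deriveEjacobian _ d1) (deriveEjacobian _ d2) j1 j2 -/J.
  by rewrite -mulmxDr subrK.
have [V [E' [oV Vx0 VU oEV [EK cE']]]] := inverse_function_id oU Ux0 cE JE.
exists V, E, E'; split=> //.
- split=> //; exact: Cinf_sub cE.
- by rewrite /E /F !subrr !mul0mx addr0.
have projJ : (1%:M - J *m Q) *m J = 0.
  by rewrite mulmxBl mul1mx -(mulmxA J) QJ mulmx1 subrr.
move=> x Vx; rewrite /E mulmxDl -(mulmxA (x - x0)) projJ mulmx0 add0r.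
by rewrite -(mulmxA (F x)) QJ mulmx1 /F addrC subrK.
Qed.

Lemma small_multiple n (v : 'rV[R]_n) e : 0 < e -> v != 0 ->
  exists a : R, a != 0 /\ `|a *: v| < e.
Proof.
move=> e0 v0; have nv : 0 < `|v| by rewrite normr_gt0.
exists (e / 2 / `|v|); split; first by rewrite !mulf_neq0 ?invr_eq0// gt_eqF.
rewrite normrZ ger0_norm; last by rewrite !divr_ge0// ltW.
by rewrite divfK ?gt_eqF//; lra.
Qed.

(** If multiplication by [B] does not lower the rank of [A], it is injective
    on the row space of [A]. *)
Lemma kernel_of_rank_le n m p q (A : 'M[R]_(n, m)) (B : 'M[R]_(m, p)) (x : 'M[R]_(q, n)) :
  (\rank A <= \rank (A *m B))%N -> x *m A *m B = 0 -> x *m A = 0.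
Proof.
move=> le e; have : \rank (A *m B) = \rank A.
  by apply/eqP; rewrite eqn_leq le mxrankM_maxl.
move=> /mxrank_injP /eqP cap0; apply/eqP; rewrite -submx0 -cap0 sub_capmx submxMl.
exact/sub_kermxP.
Qed.

(** A point of maximal rank plays the part of a regular point: around it the
    rank cannot jump up, which is all that the constant rank argument
    requires. *)
Lemma exists_max_rank k l (f : 'rV[R]_k -> 'M[R]_(k, l)) (W : set 'rV[R]_k) :
  W !=set0 -> exists2 w0, W w0 & forall w, W w -> (\rank (f w) <= \rank (f w0))%N.
Proof.
move=> [w Ww]; pose P r := `[< exists2 w, W w & \rank (f w) = r >].
have exP : exists r, P r by exists (\rank (f w)); apply/asboolP; exists w.
have bP r : P r -> (r <= k)%N by move=> /asboolP[z _ <-]; exact: rank_leq_row.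
case: (ex_maxnP exP bP) => r /asboolP[w0 Ww0 <-] max; exists w0 => // z Wz.
by apply: max; apply/asboolP; exists z.
Qed.

(** Let [J] be the Jacobian at a point [w0] of maximal rank, factored as [C
    B] through the coordinate space whose dimension is the rank, and let [A]
    be a right inverse of [B]. The map [g = f A] is a submersion at [w0], so
    it is linear in suitable coordinates [E]. By maximality of the rank, [f]
    is constant in the directions along which [g] is constant; as [f] is
    injective there are none, so [C] is invertible and [g] is injective near
    [w0]. Then no two points of the image of [f] near [f w0] differ by an
    element of the kernel of [A]; since that image is open, [A] is injective
    too. *)
Lemma open_injection_regular_point k l (f : 'rV[R]_k -> 'rV[R]_l) (W : set 'rV[R]_k) :
  open W -> W !=set0 -> Cinf W f ->
  (forall x y, W x -> W y -> f x = f y -> x = y) ->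
  (forall U, open U -> U `<=` W -> open (f @` U)) ->
  exists2 z, W z & row_free (jacobian f z) /\ row_full (jacobian f z).
Proof.
move=> oW W0 cf injf openf.
have [w0 Ww0 maxr] := exists_max_rank (jacobian f) W0.
exists w0 => //; set J := jacobian f w0 in maxr *.
pose A := pinvmx (row_base J); pose C := col_base J.
have JA : J *m A = C.
  by rewrite -[J in J *m A]mulmx_base -mulmxA mulmxVp ?mulmx1// row_base_free.
have Cfull : row_full C by exact: col_base_full.
pose g x := 0 + f x *m A.
have dfW x : W x -> differentiable f x by exact: Cinf_differentiable.
have cg : Cinf W g by apply: Cinf_D => //; [exact: Cinf_cst|exact: Cinf_mulmx].
have Jg x : W x -> jacobian g x = jacobian f x *m A.
  by move=> /dfW/(jacobian_affine 0 A)[].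
have Jg0 : jacobian g w0 = C by rewrite Jg.
have [] := @straighten _ _ W g w0 oW Ww0 cg; first by rewrite Jg0.
move=> V [E [E' [[oV Vw0 VW] [cE oEV cE'] Ew0 EK]]]; rewrite Jg0 => gE.
have E'K p : (E @` V) p -> V (E' p) /\ E (E' p) = p.
  by move=> [x Vx <-]; rewrite EK.
have dE x : V x -> differentiable E x by exact: Cinf_differentiable.
have dE' p : (E @` V) p -> differentiable E' p by exact: Cinf_differentiable.
have nV x : V x -> nbhs x V by move=> Vx; exact: open_nbhs_nbhs.
have nEV p : (E @` V) p -> nbhs p (E @` V) by move=> h; exact: open_nbhs_nbhs.
have JEE' p : (E @` V) p -> jacobian E' p *m jacobian E (E' p) = 1%:M.
  move=> EVp; have [VE' EE'] := E'K p EVp.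
  rewrite -jacobian_comp; [|exact: dE'|exact: dE].
  rewrite -(jacobian_id p); apply: jacobian_near (differentiable_idmap p).
  by apply: filterS (nEV p EVp) => q /E'K[_ /= ->].
have JgE x : V x -> jacobian g x = jacobian E x *m C.
  move=> Vx; have [d1 <-] := jacobian_affine (g w0) C (dE x Vx).
  by apply: jacobian_near d1; apply: filterS (nV x Vx) => y /gE ->.
(* Directions along which [g] is constant are directions along which [f] is
   constant, by maximality of the rank at [w0]. *)
have ker0 p v : (E @` V) p -> v *m C = 0 -> v *m jacobian E' p *m jacobian f (E' p) = 0.
  move=> EVp vC; have [Vw _] := E'K p EVp; have Ww := VW _ Vw.
  apply: (@kernel_of_rank_le _ _ _ _ _ A).
    apply: leq_trans (maxr _ Ww) _; rewrite -Jg// JgE//.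
    have fullE : row_full (jacobian E (E' p)).
      by rewrite row_full_unit; case: (mulmx1_unit (JEE' p EVp)).
    by rewrite (eqmxMfull C fullE) (eqP Cfull).
  by rewrite -(mulmxA _ _ A) -Jg// JgE// mulmxA -(mulmxA v) JEE'// mulmx1.
have EV0 : (E @` V) 0 by exists w0.
have E'0 : E' 0 = w0 by rewrite -Ew0 EK.
(* Otherwise [f] would be constant on a segment, in the coordinates [E]. *)
have Cfree : row_free C.
  apply: inj_row_free => v vC; apply/eqP; apply/negP => /negP v0.
  have /nbhs_ballP[e /= e0 sub] := nEV 0 EV0.
  have [a [a0 av]] := small_multiple e0 v0; set v' := a *: v in av.
  have v'C : v' *m C = 0 by rewrite -scalemxAl vC scaler0.
  have inEV t : 0 <= t <= 1 -> (E @` V) (0 + t *: v').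
    move=> /andP[t0 t1]; apply: sub; rewrite -ball_normE /= sub0r normrN add0r normrZ.
    by rewrite ger0_norm//; apply: le_lt_trans av; rewrite ler_piMl.
  have dh p : (E @` V) p -> differentiable (f \o E') p.
    move=> EVp; apply: differentiable_comp; first exact: dE'.
    by apply: dfW; apply: VW; have [] := E'K p EVp.
  have const : (f \o E') (0 + v') = (f \o E') 0.
    apply/eqP; rewrite -subr_eq0; apply/eqP/rowP => j.
    have [|t t01 ->] := @mvt_coord _ _ _ (f \o E') 0 v' j.
      by move=> t /inEV; exact: dh.
    have EVp := inEV t t01; have [Vp _] := E'K _ EVp.
    rewrite deriveEjacobian; last exact: dh.
    rewrite jacobian_comp; [|exact: dE'|by apply: dfW; exact: VW].
    by rewrite mulmxA ker0// !mxE.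
  have EV1 : (E @` V) (0 + v') by have := inEV 1; rewrite scale1r; apply; rewrite ler01 lexx.
  have [V1 EE1] := E'K _ EV1.
  have : E' (0 + v') = E' 0.
    by apply: injf const; [exact: VW|rewrite E'0].
  move=> /(congr1 E); rewrite EE1 E'0 Ew0 add0r => /eqP.
  by rewrite scaler_eq0 (negbTE a0) (negbTE v0).
(* Otherwise the open image contains a second point with the same value of
   [g], although [g] is injective on [V]. *)
have Afree : row_free A.
  apply: inj_row_free => u uA; apply/eqP; apply/negP => /negP u0.
  have : nbhs (f w0) (f @` V).
    by apply: open_nbhs_nbhs; split; [exact: openf|exists w0].
  move=> /nbhs_ballP[e /= e0 sub].
  have [a [a0 au]] := small_multiple e0 u0.
  have : (f @` V) (f w0 + a *: u).
    by apply: sub; rewrite -ball_normE /= opprD addrA subrr sub0r normrN.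
  move=> [w1 Vw1 fw1].
  have : E w1 *m C = 0.
    have := gE w1 Vw1; rewrite /g !add0r fw1 mulmxDl -scalemxAl uA scaler0 addr0.
    by move=> /eqP; rewrite -subr_eq0 opprD addrA subrr sub0r oppr_eq0 => /eqP.
  move=> EC; have Ew1 : E w1 = 0 by apply: (row_free_inj Cfree); rewrite /= mul0mx.
  have /eqP : a *: u = 0.
    by apply: (addrI (f w0)); rewrite addr0 -fw1 -(EK w1 Vw1) Ew1 E'0.
  by rewrite scaler_eq0 (negbTE a0) (negbTE u0).
split.
  rewrite /row_free eqn_leq rank_leq_row /=.
  by move: Cfree; rewrite /row_free => /eqP {1}<-; exact: rank_leq_col.
rewrite /row_full eqn_leq rank_leq_col /=.
by move: Afree; rewrite /row_free => /eqP {1}<-; exact: rank_leq_col.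
Qed.

End rank.

(** * Germs of smooth maps between manifolds *)

Section germs.
Variable R : realType.

(** Smoothness of the germ of [f] at [x]. *)
Definition Cnear n m (f : 'rV[R]_n -> 'rV[R]_m) x :=
  exists U, [/\ open U, U x & Cinf U f].

Lemma open_preimage (T S : topologicalType) (U : set T) (V : set S) (f : T -> S) :
  open U -> open V -> (forall x, U x -> {for x, continuous f}) ->
  open (U `&` f @^-1` V).
Proof.
move=> oU oV cf; rewrite openE => x [Ux Vfx]; apply: filterI.
  exact: open_nbhs_nbhs.
by apply: (cf x Ux); exact: open_nbhs_nbhs.
Qed.

Lemma Cnear_comp n m p (f : 'rV[R]_n -> 'rV[R]_m) (g : 'rV[R]_m -> 'rV[R]_p) x :
  Cnear f x -> Cnear g (f x) -> Cnear (g \o f) x.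
Proof.
move=> [U [oU Ux cf]] [V [oV Vfx cg]].
have cfU y : U y -> {for y, continuous f} by move=> Uy; exact: Cinf_continuous cf Uy.
exists (U `&` f @^-1` V); split=> //; first exact: open_preimage.
apply: Cinf_comp cg => //; first exact: open_preimage.
  by move=> y [].
by apply: Cinf_sub cf => y [].
Qed.

Lemma Cnear_ext n m (f g : 'rV[R]_n -> 'rV[R]_m) x :
  (\forall y \near x, f y = g y) -> Cnear f x -> Cnear g x.
Proof.
rewrite /prop_near1 nbhsE => -[W [oW Wx] WE] [U [oU Ux cf]].
exists (U `&` W); split=> //; first exact: openI.
apply: (@Cinf_ext _ _ _ _ f); first exact: openI.
  by move=> y [_ /WE].
by apply: Cinf_sub cf => y [].
Qed.

Lemma Cinf_germs n m (U : set 'rV[R]_n) (f : 'rV[R]_n -> 'rV[R]_m) :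
  (forall x, U x -> Cnear f x) -> Cinf U f.
Proof. by move=> h; apply: Cinf_local => x /h[A [_ Ax cA]]; exists A. Qed.

End germs.

Section manifolds.
Variable R : realType.

Lemma near_cinv (T : topologicalType) n (c : chart R T n) x (P : T -> Prop) :
  cdom c x -> (\forall y \near x, P y) -> \forall u \near cmap c x, P (cinv c u).
Proof.
move=> cx nP; have im : (cmap c @` cdom c) (cmap c x) by exists x.
by have := cinv_continuous im; rewrite /prop_for /continuous_at cmapK//; apply.
Qed.

Lemma near_cdom (T : topologicalType) n (c : chart R T n) x :
  cdom c x -> \forall y \near x, cdom c y.
Proof. by move=> cx; apply: open_nbhs_nbhs; split=> //; exact: cdom_open. Qed.

Lemma near_cimg (T : topologicalType) n (c : chart R T n) x :
  cdom c x -> \forall u \near cmap c x, (cmap c @` cdom c) u.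
Proof. by move=> cx; apply: open_nbhs_nbhs; split; [exact: cimg_open|exists x]. Qed.

(** Membership in the maximal atlas; the charts adapted to a submersion are
    of this kind. *)
Definition compatible (M : manifold R) (c : chart R M (mdim M)) :=
  forall d, atlas d ->
    Cinf (cmap c @` (cdom c `&` cdom d)) (cmap d \o cinv c) /\
    Cinf (cmap d @` (cdom d `&` cdom c)) (cmap c \o cinv d).

Lemma atlas_compatible (M : manifold R) (c : chart R M (mdim M)) :
  atlas c -> compatible c.
Proof. by move=> ac d ad; split; exact: atlas_compat. Qed.

(** A chart of the atlas around the point mediates between two charts which
    need not belong to it. *)
Lemma transition (M : manifold R) (c d : chart R M (mdim M)) x :
  compatible c -> compatible d -> cdom c x -> cdom d x ->
  Cnear (cmap d \o cinv c) (cmap c x).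
Proof.
move=> cc cd cx dx; have [e ae ex] := atlas_cover x.
have ce : Cnear (cmap e \o cinv c) (cmap c x).
  exists (cmap c @` (cdom c `&` cdom e)); split; last by have [] := cc e ae.
    by apply: open_overlap; exact: cdom_open.
  by exists x.
have ed : Cnear (cmap d \o cinv e) ((cmap e \o cinv c) (cmap c x)).
  rewrite /= cmapK//.
  exists (cmap e @` (cdom e `&` cdom d)); split; last by have [] := cd e ae.
    by apply: open_overlap; exact: cdom_open.
  by exists x.
apply: Cnear_ext (Cnear_comp ce ed).
have := near_cinv cx (near_cdom ex); apply: filterS => u eu /=.
by rewrite cmapK.
Qed.

(** Smoothness near one point, tested in one pair of compatible charts;
    [smooth_at_charts] shows that the choice of charts is immaterial. *)
Definition smooth_at (M N : manifold R) (f : M -> N) (x : M) :=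
  (\forall y \near x, {for y, continuous f}) /\
  exists c d, [/\ compatible c, compatible d, cdom c x, cdom d (f x) &
                  Cnear (cmap d \o f \o cinv c) (cmap c x)].

Lemma smooth_at_continuous (M N : manifold R) (f : M -> N) (x : M) :
  smooth_at f x -> {for x, continuous f}.
Proof. by move=> [/nbhs_singleton]. Qed.

(** Insert the transition maps to the charts in which smoothness is known. *)
Lemma smooth_at_charts (M N : manifold R) (f : M -> N) (x : M) c d :
  smooth_at f x -> compatible c -> compatible d -> cdom c x -> cdom d (f x) ->
  Cnear (cmap d \o f \o cinv c) (cmap c x).
Proof.
move=> sf cc cd cx dfx; have cfx := smooth_at_continuous sf.
have [_ [c' [d' [cc' cd' cx' dfx' cn]]]] := sf.
have t1 := transition cc cc' cx cx'.
have t2 : Cnear (cmap d' \o f \o cinv c') ((cmap c' \o cinv c) (cmap c x)).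
  by rewrite /= cmapK.
have t12 := Cnear_comp t1 t2.
have t3 : Cnear (cmap d \o cinv d')
    (((cmap d' \o f \o cinv c') \o (cmap c' \o cinv c)) (cmap c x)).
  by rewrite /= !cmapK//; exact: transition.
apply: Cnear_ext (Cnear_comp t12 t3).
have n1 := near_cinv cx (near_cdom cx').
have n2 := near_cinv cx (cfx _ (near_cdom dfx')).
by apply: filterS2 n1 n2 => u /= h1 h2; rewrite !cmapK.
Qed.

Lemma smooth_at_comp (M N P : manifold R) (f : M -> N) (g : N -> P) (x : M) :
  smooth_at f x -> smooth_at g (f x) -> smooth_at (g \o f) x.
Proof.
move=> sf sg; have cfx := smooth_at_continuous sf.
have [nf [c [d [cc cd cx dfx cn]]]] := sf.
have [ng [_ [e [_ ce _ egx _]]]] := sg.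
split.
  by apply: filterS2 nf (cfx _ ng) => y cfy cgy; exact: continuous_comp.
exists c, e; split=> //.
have t2 : Cnear (cmap e \o g \o cinv d) ((cmap d \o f \o cinv c) (cmap c x)).
  by rewrite /= cmapK//; exact: smooth_at_charts sg cd ce dfx egx.
apply: Cnear_ext (Cnear_comp cn t2).
have := near_cinv cx (cfx _ (near_cdom dfx)).
by apply: filterS => u /= h; rewrite cmapK.
Qed.

Lemma smooth_at_ext (M N : manifold R) (f g : M -> N) (x : M) :
  (\forall y \near x, f y = g y) -> smooth_at f x -> smooth_at g x.
Proof.
move=> fg [nf [c [d [cc cd cx dfx cn]]]]; split.
  have nfg : \forall y \near x, \forall z \near y, f z = g z by exact: nbhs_interior fg.
  apply: filterS2 nf nfg => y cfy fgy.
  rewrite /prop_for /continuous_at -(nbhs_singleton fgy).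
  by apply: cvg_trans cfy; exact: near_eq_cvg.
exists c, d; split=> //; first by rewrite -(nbhs_singleton fg).
apply: Cnear_ext cn; have := near_cinv cx fg.
by apply: filterS => u /= ->.
Qed.

Lemma smooth_in_at (M N : manifold R) (W : set M) (f : M -> N) x :
  open W -> W x -> smooth_in W f -> smooth_at f x.
Proof.
move=> oW Wx [cf sf]; split.
  have nW : nbhs x W by exact: open_nbhs_nbhs.
  by apply: filterS nW => y; exact: cf.
have [c ac cx] := atlas_cover x; have [d ad dfx] := atlas_cover (f x).
exists c, d; split=> //; [exact: atlas_compatible..|].
exists (cmap c @` (W `&` cdom c `&` f @^-1` cdom d)); split.
- rewrite (setIC W) -setIA; apply: open_overlap; apply: open_preimage => //.
  exact: cdom_open.
- by exists x.
- exact: sf.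
Qed.

Lemma smooth_at_all (M N : manifold R) (f : M -> N) :
  smooth f <-> forall x, smooth_at f x.
Proof.
split=> [sf x|sf]; first by apply: smooth_in_at sf => //; exact: openT.
split=> [x _|c d ac ad]; first exact: smooth_at_continuous.
apply: Cinf_germs => _ [x [[_ cx] dfx] <-].
exact: smooth_at_charts (sf x) (atlas_compatible ac) (atlas_compatible ad) cx dfx.
Qed.

Lemma smooth_at_id (M : manifold R) (x : M) : smooth_at id x.
Proof.
split; first by apply: nearW => y; exact: cvg_id.
have [c ac cx] := atlas_cover x; have cc := atlas_compatible ac.
exists c, c; split=> //; exact: transition.
Qed.

Lemma smooth_at_pair (M N P : manifold R) (f : M -> N) (g : M -> P) (x : M) :
  smooth_at f x -> smooth_at g x ->
  @smooth_at M (prod_manifold N P) (fun y => (f y, g y)) x.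
Proof.
move=> sf sg; split.
  by have [nf _] := sf; have [ng _] := sg; apply: filterS2 nf ng => y cfy cgy; exact: cvg_pair.
have [c ac cx] := atlas_cover x.
have [d ad dfx] := atlas_cover (f x); have [e ae egx] := atlas_cover (g x).
have cc := atlas_compatible ac.
exists c, (prod_chart d e); split=> //.
  by apply: atlas_compatible; exists (d, e).
have [U [oU Ux cU]] := smooth_at_charts sf cc (atlas_compatible ad) cx dfx.
have [V [oV Vx cV]] := smooth_at_charts sg cc (atlas_compatible ae) cx egx.
exists (U `&` V); split=> //; first exact: openI.
have oUV := openI oU oV.
have -> : cmap (prod_chart d e) \o (fun y => (f y, g y)) \o cinv c = fun u =>
    (cmap d \o f \o cinv c) u *m row_mx 1%:M 0 +
    (cmap e \o g \o cinv c) u *m row_mx 0 1%:M.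
  by apply/funext => u; rewrite /= /prod_cmap /= row_mxE_linear.
apply: Cinf_D => //; apply: Cinf_mulmx => //.
  by apply: Cinf_sub cU => ? [].
by apply: Cinf_sub cV => ? [].
Qed.

End manifolds.

(** * Submersions *)

Section submersions.
Variable R : realType.

Lemma cinvK (T : topologicalType) n (c : chart R T n) u :
  (cmap c @` cdom c) u -> cdom c (cinv c u) /\ cmap c (cinv c u) = u.
Proof. by move=> [x cx <-]; rewrite cmapK. Qed.

Section straightened_chart.
Variables (M : manifold R) (c : chart R M (mdim M)).
Variables (V : set 'rV[R]_(mdim M)) (E E' : 'rV[R]_(mdim M) -> 'rV[R]_(mdim M)).
Hypotheses (cc : compatible c) (oV : open V) (Vc : V `<=` cmap c @` cdom c).
Hypotheses (cE : Cinf V E) (oEV : open (E @` V)) (cE' : Cinf (E @` V) E').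
Hypothesis (EK : forall u, V u -> E' (E u) = u).

Let dom := cdom c `&` cmap c @^-1` V.

Let domE : (E \o cmap c) @` dom = E @` V.
Proof.
apply/seteqP; split=> [_ [x [cx Vx] <-]|_ [u Vu <-]]; first by exists (cmap c x).
have [x cx xu] := Vc Vu; exists x; last by rewrite /= xu.
by split=> //; rewrite /= xu.
Qed.

Let dom_open : open dom.
Proof.
apply: open_preimage => //; first exact: cdom_open.
by move=> x; exact: cmap_continuous.
Qed.

Let img_open : open ((E \o cmap c) @` dom).
Proof. by rewrite domE. Qed.

Let map_continuous x : dom x -> {for x, continuous (E \o cmap c)}.
Proof.
move=> [cx Vx]; apply: continuous_comp; first exact: cmap_continuous.
exact: Cinf_continuous cE Vx.
Qed.

Let inv_continuous u : ((E \o cmap c) @` dom) u -> {for u, continuous (cinv c \o E')}.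
Proof.
rewrite domE => EVu; apply: continuous_comp; first exact: Cinf_continuous cE' EVu.
by apply: cinv_continuous; move: EVu => [v Vv <-]; rewrite EK//; exact: Vc.
Qed.

Let mapK x : dom x -> (cinv c \o E') ((E \o cmap c) x) = x.
Proof. by move=> [cx Vx] /=; rewrite EK// cmapK. Qed.

Definition reparam_chart : chart R M (mdim M) :=
  Chart dom_open img_open map_continuous inv_continuous mapK.

Lemma reparam_chart_compatible : compatible reparam_chart.
Proof.
move=> d ad; have cd := atlas_compatible ad; split; apply: Cinf_germs.
  move=> _ [x [[cx Vx] dx] <-] /=.
  rewrite -[_ \o _]/((cmap d \o cinv c) \o E'); apply: Cnear_comp.
    by exists (E @` V); split=> //; exists (cmap c x).
  by rewrite EK//; exact: transition.
move=> _ [x [dx [cx Vx]] <-] /=.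
rewrite -[_ \o _]/(E \o (cmap c \o cinv d)); apply: Cnear_comp.
  exact: transition.
by rewrite /= cmapK//; exists V.
Qed.

End straightened_chart.

Lemma surj_row_full n m (f : 'rV[R]_n -> 'rV[R]_m) x :
  set_surj setT setT ('d f x) -> row_full (jacobian f x).
Proof.
move=> sf; rewrite -sub1mx; apply/row_subP => i.
have [u _ <-] := sf (row i 1%:M) I.
by rewrite -(mul_rV_lin1 ('d f x)) submxMl.
Qed.

(** The submersion theorem: in the coordinates that straighten a chart
    expression of [s], the map [s] is affine. *)
Lemma submersion_chart (M X : manifold R) (s : M -> X) g0 (e : chart R X (mdim X)) :
  submersion s -> atlas e -> cdom e (s g0) ->
  exists (c : chart R M (mdim M)) (J : 'M[R]_(mdim M, mdim X)),
    [/\ compatible c, cdom c g0, cmap c g0 = 0, row_full J &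
        forall y, cdom c y -> cdom e (s y) /\
          cmap e (s y) = cmap e (s g0) + cmap c y *m J].
Proof.
move=> [ss surj] ae esg0; have [c ac cg0] := atlas_cover g0.
have cc := atlas_compatible ac; have [cs /(_ c e ac ae) cS] := ss.
set U := (X in Cinf X _) in cS; set S := (X in Cinf _ X) in cS.
have oU : open U.
  rewrite /U setTI; apply: open_overlap; apply: open_comp (cdom_open e) => x _.
  exact: cs.
have Uc : U `<=` cmap c @` cdom c by move=> _ [x [[_ cx] _] <-]; exists x.
have UP u : U u -> cdom e (s (cinv c u)) by move=> [x [[_ cx] ex] <-]; rewrite cmapK.
have Ug0 : U (cmap c g0) by exists g0.
have full : row_full (jacobian S (cmap c g0)).
  by apply: surj_row_full; exact: surj.
have [V [E [E' [[oV Vg0 VU] [cE oEV cE'] E0 EK SE]]]] := straighten oU Ug0 cS full.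
have Vc : V `<=` cmap c @` cdom c by move=> u /VU/Uc.
exists (reparam_chart oV Vc cE oEV cE' EK), (jacobian S (cmap c g0)).
split=> //; first exact: reparam_chart_compatible.
move=> y [/= cy Vy]; split; first by rewrite -[y](cmapK cy); apply: UP; exact: VU.
by have := SE _ Vy; rewrite /S /= !cmapK.
Qed.

(** In a chart that makes [s] affine with linear part [J], a right inverse of
    [J] provides the section. *)
Lemma local_section (M X : manifold R) (s : M -> X) g0 : submersion s ->
  exists tau : X -> M, [/\ smooth_at tau (s g0), tau (s g0) = g0 &
    \forall z \near s g0, s (tau z) = z].
Proof.
move=> sub; have [e ae ex] := atlas_cover (s g0).
have [c [J [cc cg0 c0 Jfull cJ]]] := submersion_chart sub ae ex.
pose q u := (u - cmap e (s g0)) *m pinvmx J.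
pose tau z := cinv c (q (cmap e z)).
have cq : Cinf setT q.
  have oT : open (setT : set 'rV[R]_(mdim X)) := openT.
  by apply: Cinf_mulmx => //; apply: Cinf_D => //; [exact: Cinf_id|exact: Cinf_cst].
have q0 : q (cmap e (s g0)) = cmap c g0 by rewrite c0 /q subrr mul0mx.
have cqe z : cdom e z -> {for z, continuous (q \o cmap e)}.
  move=> ez; apply: continuous_comp; first exact: cmap_continuous.
  exact: Cinf_continuous cq I.
have tau0 : tau (s g0) = g0 by rewrite /tau q0 cmapK.
have nq : \forall z \near s g0, (cmap c @` cdom c) (q (cmap e z)).
  by apply: (cqe _ ex); rewrite /= q0; exact: near_cimg.
exists tau; split=> //; last first.
  apply: filterS2 (near_cdom ex) nq => z ez /cinvK[ct ctq].
  have [et] := cJ _ ct; rewrite ctq /q -mulmxA mulVpmx// mulmx1 addrCA subrr addr0.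
  by move=> /(congr1 (cinv e)); rewrite !cmapK.
split.
  apply: filterS2 (near_cdom ex) nq => z ez qz.
  apply: (@continuous_comp _ _ _ (q \o cmap e) (cinv c)); first exact: cqe.
  exact: cinv_continuous.
exists e, c; split=> //; [exact: atlas_compatible|by rewrite tau0|].
apply: (@Cnear_ext _ _ _ q); last by exists setT; split=> //; exact: openT.
apply: filterS2 (near_cimg ex) (near_cinv ex nq) => u /cinvK[_ eu].
by rewrite /= /tau eu => /cinvK[_ ->].
Qed.

End submersions.

(** * The Baire argument *)

Section baire.
Variable R : realType.

(** If no [F i] contained an open piece of [O], the complements of the [F i],
    enlarged by the exterior of [O] to become dense in the whole space, would
    meet inside [O] by the Baire theorem. *)
Lemma baire_cover l (O : set 'rV[R]_l) (F : nat -> set 'rV[R]_l) :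
  open O -> O !=set0 -> (forall i, open (O `\` F i)) -> O `<=` \bigcup_i F i ->
  exists i O', [/\ open O', O' !=set0 & O' `<=` O `&` F i].
Proof.
move=> oO O0 oF cov; apply: contrapT => no.
pose G i := (O `\` F i) `|` ~` closure O.
have oG i : open (G i) by apply: openU => //; exact/closed_openC/closed_closure.
have dG i : dense (G i).
  move=> D D0 oD; have [[z [Dz Oz]]|DO] := pselect (D `&` O !=set0).
    apply: contrapT => noG; apply: no; exists i, (D `&` O); split.
    - exact: openI.
    - by exists z.
    move=> w [Dw Ow]; split=> //; apply: contrapT => nFw.
    by apply: noG; exists w; split=> //; left.
  have [z Dz] := D0; exists z; split=> //; right => clz.
  by apply: DO; rewrite setIC; apply: clz; exact: open_nbhs_nbhs.
have [z [Oz Gz]] := Baire (fun i => conj (oG i) (dG i)) O0 oO.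
have [i _ Fz] := cov z Oz.
by have [[_ /(_ Fz)]|] := Gz i I => // ncl; apply: ncl; exact: subset_closure.
Qed.

(** The inverse chart carries a small closed ball to a compact neighbourhood. *)
Lemma manifold_compact_nbhs (M : manifold R) (g : M) :
  exists2 K : set M, compact K & nbhs g K.
Proof.
have [c _ cg] := atlas_cover g.
have /nbhs_closedballP[r sub] := near_cimg cg.
set B := closed_ball _ _ in sub.
exists (cinv c @` B).
  apply: continuous_compact.
    apply: continuous_in_subspaceT => u; rewrite inE => /sub; exact: cinv_continuous.
  apply: bounded_closed_compact; last exact: closed_ball_closed.
  exists (`|cmap c g| + r%:num); split; first exact: num_real.
  move=> t ht u; rewrite /B closed_ballE// /closed_ball_ /= => hu.
  apply: ltW; apply: le_lt_trans ht.
  rewrite -[u](subrK (cmap c g)) addrC; apply: le_trans (ler_normD _ _) _.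
  by rewrite lerD2l distrC.
have nB : nbhs (cmap c g) B.
  apply: filterS (nbhsx_ballx (cmap c g) r%:num _) => //.
  exact: subset_closed_ball.
have nBc : \forall y \near g, B (cmap c y) := cmap_continuous cg nB.
by apply: filterS2 (near_cdom cg) nBc => y cy By; exists (cmap c y) => //; rewrite cmapK.
Qed.

(** Second countability and local compactness provide countably many compact
    sets covering [M]; their images under [f] are closed, so by Baire one of
    them contains [a z] for all [z] in some nonempty open set. On a compact
    set the inverse of a continuous injection into a Hausdorff space is
    continuous. *)
Lemma continuous_bijection_inverse_somewhere (M N : manifold R) (f : M -> N) (g : N -> M)
    l (a : 'rV[R]_l -> N) (O : set 'rV[R]_l) :
  continuous f -> cancel f g -> cancel g f ->
  open O -> O !=set0 -> (forall z, O z -> {for z, continuous a}) ->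
  exists O', [/\ open O', O' !=set0, O' `<=` O &
    forall z, O' z -> {for z, continuous (g \o a)}].
Proof.
move=> cf fK gK oO O0 ca.
have [B cB [oB bB]] := msecond_countable M.
have [ix ixinj] := countable_injP _ cB.
(* [K b] is empty for the basic sets contained in no compact set. *)
pose K b := xget set0 [set K : set M | compact K /\ b `<=` K].
have cK b : compact (K b).
  rewrite /K; have [[K' hK']|no] :=
    pselect (exists K', [set K : set M | compact K /\ b `<=` K] K').
    by have [] := xgetPex set0 (ex_intro _ K' hK').
  rewrite xgetPN; first exact: compact0.
  by move=> K' hK'; apply: no; exists K'.
have clfK (C : set M) : compact C -> closed (f @` C).
  move=> cC; apply: compact_closed; first exact: mhausdorff.
  by apply: continuous_compact => //; exact: continuous_subspaceT.
(* Injectivity of [ix] makes each [F n] the preimage of one compact image. *)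
pose F n := [set z | exists b, [/\ B b, ix b = n & (f @` K b) (a z)]].
have [||i [W [oW W0 WF]]] := @baire_cover l O F oO O0.
- move=> n; have [[b [Bb ixb]]|no] := pselect (exists b, B b /\ ix b = n).
    rewrite (_ : O `\` F n = O `&` a @^-1` ~` (f @` K b)).
      by apply: open_preimage => //; apply/closed_openC; exact: clfK.
    apply/seteqP; split=> z [Oz nF]; split=> //.
      by move=> fKz; apply: nF; exists b.
    move=> [b' [Bb' ixb' fK']]; apply: nF.
    by rewrite (ixinj b b') ?inE// ixb ixb'.
  rewrite (_ : O `\` F n = O)//; apply/seteqP; split=> [z []//|z Oz]; split=> //.
  by move=> [b [Bb ixb _]]; apply: no; exists b.
- move=> z Oz; have [K' cK' nK'] := manifold_compact_nbhs (g (a z)).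
  have [b [Bb bg] bK'] := bB _ _ nK'; exists (ix b) => //; exists b; split=> //.
  exists (g (a z)) => //.
  have exK : exists K', [set K : set M | compact K /\ b `<=` K] K' by exists K'.
  have [_ bK] := xgetPex set0 exK.
  exact: bK.
exists W; split=> //; first by move=> z /WF[].
move=> z Wz; have [Oz [b [Bb ixb fKz]]] := WF z Wz.
have WK w : W w -> K b (g (a w)).
  move=> /WF[_ [b' [Bb' ixb' [m Km <-]]]]; rewrite fK.
  by rewrite (ixinj b b') ?inE// ixb ixb'.
move=> A /=; rewrite nbhsE => -[A' [oA' A'z] A'A].
have cl : closed (f @` (K b `\` A')).
  have clD : closed (K b `\` A').
    apply: closedI; last exact: open_closedC.
    by apply: compact_closed => //; exact: mhausdorff.
  by apply: clfK; apply: subclosed_compact clD (cK b) _; exact: subDsetl.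
have : nbhs (a z) (~` (f @` (K b `\` A'))).
  apply: open_nbhs_nbhs; split; first exact/closed_openC.
  by move=> [m [_ nA'] fm]; apply: nA'; rewrite -(fK m) fm.
move=> /(ca z Oz) nz; have nW : nbhs z W by exact: open_nbhs_nbhs.
apply: filterS2 nW nz => w Ww nw; apply: A'A; apply: contrapT => nA'.
by apply: nw; exists (g (a w)); [split=> //; exact: WK|rewrite gK].
Qed.

End baire.

(** * A point of smoothness in each fibre *)

Section linear_algebra.
Variable F : fieldType.

(** The rows of [row_base (kermx J)] form a basis of the kernel of [J], and
    its partial inverse computes coordinates in that basis. *)
Lemma kernel_param n m (J : 'M[F]_(n, m)) (w : 'rV[F]_n) : w *m J = 0 ->
  w *m pinvmx (row_base (kermx J)) *m row_base (kermx J) = w.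
Proof. by move=> wJ; apply: mulmxKpV; rewrite eq_row_base; exact/sub_kermxP. Qed.

Lemma kernel_param0 n m (J : 'M[F]_(n, m)) : row_base (kermx J) *m J = 0.
Proof. by apply/sub_kermxP; rewrite eq_row_base. Qed.

Lemma kernel_paramK n m (J : 'M[F]_(n, m)) :
  row_base (kermx J) *m pinvmx (row_base (kermx J)) = 1%:M.
Proof. by apply: mulmxVp; exact: row_base_free. Qed.

(** A version of the five lemma: [L] induces the identity on the quotients by
    the kernels of [JG] and [JD], and an isomorphism between these kernels,
    here read in coordinates. *)
Lemma bijective_on_kernels n p m (L : 'M[F]_(n, p)) (JG : 'M[F]_(n, m))
    (JD : 'M[F]_(p, m)) :
  L *m JD = JG -> row_full JG ->
  row_free (row_base (kermx JG) *m L *m pinvmx (row_base (kermx JD))) ->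
  row_full (row_base (kermx JG) *m L *m pinvmx (row_base (kermx JD))) ->
  row_free L /\ row_full L.
Proof.
move=> LJ fJG; set KG := row_base (kermx JG); set KD := row_base (kermx JD).
set M := _ *m pinvmx KD => Mfree Mfull.
have KL : KG *m L = M *m KD.
  apply/esym/mulmxKpV; rewrite eq_row_base; apply/sub_kermxP.
  by rewrite -mulmxA LJ kernel_param0.
split.
  apply: inj_row_free => v vL.
  have vJ : v *m JG = 0 by rewrite -LJ mulmxA vL mul0mx.
  have := kernel_param vJ; rewrite -/KG; set z := _ *m pinvmx KG => zK.
  suff z0 : z = 0 by rewrite -zK z0 mul0mx.
  apply: (row_free_inj Mfree); apply: (row_free_inj (row_base_free (kermx JD))).
  by rewrite /= -/KD !mul0mx -mulmxA -KL mulmxA zK.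
rewrite -sub1mx; apply/row_subP => i; set w := row i _.
pose u := w *m JD *m pinvmx JG.
have uJ : u *m JG = w *m JD by rewrite /u -mulmxA mulVpmx// mulmx1.
have wuJ : (w - u *m L) *m JD = 0 by rewrite mulmxBl -mulmxA LJ uJ subrr.
have := kernel_param wuJ; rewrite -/KD; set z := _ *m pinvmx KD => zK.
have -> : w = (u + z *m pinvmx M *m KG) *m L; last exact: submxMl.
rewrite mulmxDl -mulmxA KL mulmxA -(mulmxA z) mulVpmx// mulmx1 zK addrC subrK.
by [].
Qed.

End linear_algebra.

Section fibres.
Variable R : realType.

(** A smooth bijection over [X] between total spaces of submersions has its
    inverse smooth at some point of every fibre. In adapted charts the fibres
    become the kernels of [JG] and [JD], parametrized by [b] and [a]; [fz] is
    the expression of [f] between the fibres. It is injective, and open where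
    the inverse is continuous along the fibre, so it has an invertible
    Jacobian somewhere, and then so does [f]. *)
Lemma inverse_smooth_somewhere_in_fibre (M N X : manifold R) (s : M -> X) (t : N -> X)
    (f : M -> N) (g : N -> M) (h0 : N) :
  submersion s -> submersion t -> smooth f -> (forall y, t (f y) = s y) ->
  cancel f g -> cancel g f -> exists2 h, t h = t h0 & smooth_at g h.
Proof.
move=> subs subt smf tf fK gK; have [e ae ex] := atlas_cover (t h0).
have cf : continuous f by move=> y; exact: smf.1.
have sfat : forall y, smooth_at f y by apply/smooth_at_all.
have [d [JD [cd dh0 d0 JDfull dJ]]] := submersion_chart subt ae ex.
pose KD := row_base (kermx JD).
pose a z := cinv d (z *m KD).
pose O := (fun z => z *m KD) @^-1` (cmap d @` cdom d).
have oO : open O by apply: open_mulmx_preimage; exact: cimg_open.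
have O0 : O 0 by exists h0 => //; rewrite mul0mx.
have aP z : O z -> [/\ cdom d (a z), cmap d (a z) = z *m KD & t (a z) = t h0].
  move=> /cinvK[da aK]; split=> //; have [et] := dJ _ da.
  rewrite aK -mulmxA kernel_param0 mulmx0 addr0 => /(congr1 (cinv e)).
  by rewrite !cmapK.
have mulc n m (A : 'M[R]_(n, m)) : continuous (fun z : 'rV[R]_n => z *m A).
  by move=> z; exact: (@linear_rV_continuous _ _ _ (mulmxr A)).
have ca z : O z -> {for z, continuous a}.
  by move=> Oz; exact: (continuous_comp (mulc _ _ KD z) (cinv_continuous Oz)).
(* From here on, [W] is an open piece of the fibre on which [g] is continuous. *)
have [|W [oW [z1 Wz1] WO cga]] := continuous_bijection_inverse_somewhere cf fK gK oO _ ca.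
  by exists 0.
pose g1 := g (a z1); have [da1 da1K ta1] := aP _ (WO _ Wz1).
have sg1 : s g1 = t h0 by rewrite -tf gK.
have ex1 : cdom e (s g1) by rewrite sg1.
have [c [JG [cc cg1 c0 JGfull cJ]]] := submersion_chart subs ae ex1.
rewrite sg1 in cJ.
pose KG := row_base (kermx JG).
pose b z := cinv c (z *m KG).
pose OG := (fun z => z *m KG) @^-1` (cmap c @` cdom c).
have oOG : open OG by apply: open_mulmx_preimage; exact: cimg_open.
have bP z : OG z -> [/\ cdom c (b z), cmap c (b z) = z *m KG & s (b z) = t h0].
  move=> /cinvK[cb bK]; split=> //; have [et] := cJ _ cb.
  rewrite bK -mulmxA kernel_param0 mulmx0 addr0 => /(congr1 (cinv e)).
  by rewrite !cmapK.
have cb z : OG z -> {for z, continuous b}.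
  by move=> Oz; exact: (continuous_comp (mulc _ _ KG z) (cinv_continuous Oz)).
pose fz z := cmap d (f (b z)) *m pinvmx KD.
pose D1 := OG `&` (f \o b) @^-1` cdom d.
pose D := D1 `&` fz @^-1` W.
have oD1 : open D1.
  apply: open_preimage => //; first exact: cdom_open.
  by move=> z Oz; apply: continuous_comp; [exact: cb|exact: cf].
have oD : open D.
  apply: open_preimage oD1 oW _ => z [Oz dz].
  have cfb := continuous_comp (cb z Oz) (cf (b z)).
  exact: (continuous_comp (continuous_comp cfb (cmap_continuous dz)) (mulc _ _ (pinvmx KD) _)).
have b0 : b 0 = g1 by rewrite /b mul0mx -c0 cmapK.
have D0 : D !=set0.
  exists 0; split; first split.
  - by exists g1 => //; rewrite mul0mx.
  - by rewrite /= b0 /g1 gK.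
  - by rewrite /= /fz b0 /g1 gK da1K -mulmxA kernel_paramK mulmx1.
have fbP z : D1 z -> f (b z) = a (fz z).
  move=> [/bP[cbz bKz sbz] dz]; have [_] := dJ _ dz.
  rewrite tf sbz => /eqP; rewrite eq_sym addrC -subr_eq0 addrK => /eqP fJ.
  by rewrite /a /fz kernel_param// cmapK.
have fzE z : D1 z -> fz z *m KD = cmap d (f (b z)).
  move=> [/bP[cbz bKz sbz] dz]; have [_] := dJ _ dz.
  rewrite tf sbz => /eqP; rewrite eq_sym addrC -subr_eq0 addrK => /eqP fJ.
  by rewrite /fz kernel_param.
pose F := cmap d \o f \o cinv c.
have CF z : D1 z -> Cnear F (z *m KG).
  move=> [/bP[cbz <- _] dz]; exact: smooth_at_charts (sfat (b z)) cc cd cbz dz.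
have Cmul n m (A : 'M[R]_(n, m)) z : Cnear (fun z : 'rV[R]_n => z *m A) z.
  exists setT; split=> //; first exact: openT.
  by apply: Cinf_mulmx; [exact: openT|exact: Cinf_id].
have Cfz : Cinf D fz.
  apply: Cinf_germs => z [D1z _].
  exact: (Cnear_comp (Cnear_comp (Cmul _ _ KG z) (CF z D1z)) (Cmul _ _ (pinvmx KD) _)).
have injfz x y : D x -> D y -> fz x = fz y -> x = y.
  move=> [D1x _] [D1y _] fxy.
  have bxy : b x = b y by rewrite -[b x]fK -[b y]fK !fbP// fxy.
  have [[_ bx _] [_ by_ _]] := (bP _ D1x.1, bP _ D1y.1).
  by apply: (row_free_inj (row_base_free (kermx JG))); rewrite /= -/KG -bx -by_ bxy.
(* Continuity of [g] along the fibre keeps preimages of nearby points nearby. *)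
have openfz U : open U -> U `<=` D -> open (fz @` U).
  move=> oU UD; rewrite openE => _ [z Uz <-]; have [D1z Wz] := UD _ Uz.
  have [cbz bKz sbz] := bP _ D1z.1.
  have gaz : g (a (fz z)) = b z by rewrite -fbP// fK.
  have cq : {for fz z, continuous (g \o a)} by exact: cga.
  have n1 : nbhs (fz z) W by exact: open_nbhs_nbhs.
  have n2 : \forall y \near fz z, cdom c (g (a y)).
    by apply: cq; rewrite /= gaz; exact: near_cdom.
  have n3 : \forall y \near fz z, U (cmap c (g (a y)) *m pinvmx KG).
    have cqq : {for fz z, continuous (fun y => (cmap c \o (g \o a)) y *m pinvmx KG)}.
      have cc2 : {for (g \o a) (fz z), continuous (cmap c)}.
        by apply: cmap_continuous; rewrite /= gaz.
      exact: (continuous_comp (continuous_comp cq cc2) (mulc _ _ (pinvmx KG) _)).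
    apply: cqq; rewrite /= gaz bKz -mulmxA kernel_paramK mulmx1.
    exact: open_nbhs_nbhs.
  apply: filterS3 n1 n2 n3 => y Wy cy Uy.
  set z' := _ *m pinvmx KG in Uy; exists z' => //.
  have [day aKy tay] := aP _ (WO _ Wy).
  have z'K : z' *m KG = cmap c (g (a y)).
    apply: kernel_param; have [_] := cJ _ cy.
    by rewrite -tf gK tay => /eqP; rewrite eq_sym addrC -subr_eq0 addrK => /eqP.
  have bz' : b z' = g (a y) by rewrite /b z'K cmapK.
  by rewrite /fz bz' gK aKy -mulmxA kernel_paramK mulmx1.
have [z2 [D1z2 _] [free2 full2]] := open_injection_regular_point oD D0 Cfz injfz openfz.
have [cb2 bK2 sb2] := bP _ D1z2.1.
pose g2 := b z2; pose w2 := z2 *m KG; have d2 : cdom d (f g2) := D1z2.2.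
exists (f g2); first by rewrite tf.
have [U [oU Uw2 cU]] := CF _ D1z2.
have dF : differentiable F w2 by exact: Cinf_differentiable cU Uw2.
have dom2 : \forall w \near w2, cdom d (f (cinv c w)).
  rewrite /w2 -bK2; apply: (near_cinv (P := fun y => cdom d (f y)) cb2).
  by apply: (cf _ _); exact: near_cdom.
have img2 : \forall w \near w2, (cmap c @` cdom c) w.
  by rewrite /w2 -bK2; exact: near_cimg.
(* The full differential of [f] at the regular point found on the fibre. *)
pose L := jacobian F w2.
have LJ : L *m JD = JG.
  have [d1 <-] := jacobian_affine 0 JD dF.
  have [d3 <-] := differentiable_affine 0 JG w2.
  apply/esym; apply: jacobian_near d1; apply: filterS2 dom2 img2 => w dw /cinvK[cw cKw].
  have [_] := dJ _ dw; have [_] := cJ _ cw; rewrite tf => -> /addrI.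
  by rewrite cKw !add0r => ->.
have dz2 : differentiable (fun z : 'rV[R]_(\rank (kermx JG)) => z *m KG) z2 /\
    jacobian (fun z : 'rV[R]_(\rank (kermx JG)) => z *m KG) z2 = KG.
  have [d1 j1] := differentiable_affine 0 KG z2.
  have e0 : (fun z : 'rV[R]_(\rank (kermx JG)) => 0 + z *m KG) = (fun z => z *m KG).
    by apply/funext => z; rewrite add0r.
  by rewrite e0 in d1 j1.
have Jfz : jacobian fz z2 = KG *m L *m pinvmx KD.
  have dFz : differentiable (F \o (fun z => z *m KG)) z2 by apply: differentiable_comp dz2.1 dF.
  have [d1 j1] := jacobian_affine 0 (pinvmx KD) dFz.
  have e0 : (fun z => 0 + (F \o (fun z => z *m KG)) z *m pinvmx KD) = fz.
    by apply/funext => z; rewrite add0r.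
  rewrite e0 in j1; rewrite j1 jacobian_comp//; last exact: dz2.1.
  by rewrite dz2.2.
rewrite Jfz in free2 full2.
have [Lfree Lfull] := bijective_on_kernels LJ JGfull free2 full2.
have : nbhs w2 ([set w | cdom d (f (cinv c w))] `&` (cmap c @` cdom c)) by exact: filterI.
rewrite nbhsE => -[U' [oU' U'w2] U'P].
have cUU : Cinf (U `&` U') F by apply: Cinf_sub cU => ? [].
have [V [G [oV Vw2 VU oFV [GK cG]]]] :=
  inverse_function (openI oU oU') (conj Uw2 U'w2) cUU Lfree Lfull.
have Fw2 : cmap d (f g2) = F w2 by rewrite /F /= /w2 -bK2 cmapK.
have FV2 : (F @` V) (cmap d (f g2)) by exists w2 => //; rewrite Fw2.
have nFV : \forall y \near f g2, (F @` V) (cmap d y).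
  by apply: (cmap_continuous d2); exact: open_nbhs_nbhs.
have Vimg w : V w -> (cmap c @` cdom c) w /\ cdom d (f (cinv c w)).
  by move=> /VU[_ /U'P[? ?]].
pose psi := cinv c \o (G \o cmap d).
apply: (@smooth_at_ext _ _ _ psi).
  apply: filterS2 (near_cdom d2) nFV => y dy [w Vw Fw].
  have [_ dw] := Vimg w Vw.
  have <- : f (cinv c w) = y by rewrite -[LHS](cmapK dw) -[RHS](cmapK dy); congr (cinv d _).
  by rewrite fK /psi /= -[cmap d _]/(F w) GK.
split.
  apply: filterS2 (near_cdom d2) nFV => y dy FVy; apply: continuous_comp.
    by apply: continuous_comp; [exact: cmap_continuous|exact: Cinf_continuous cG FVy].
  by apply: cinv_continuous; move: FVy => [w Vw /= <-]; rewrite GK//; exact: (Vimg w Vw).1.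
exists d, c; split=> //.
  by rewrite /psi /= Fw2 GK//; exact: (cinvK (Vimg _ Vw2).1).1.
apply: (@Cnear_ext _ _ _ G); last by exists (F @` V).
have nFV' : nbhs (cmap d (f g2)) (F @` V) by exact: open_nbhs_nbhs.
apply: filterS2 (near_cimg d2) nFV' => u /cinvK[_ du] [w Vw Fw].
by rewrite /psi /= du -Fw GK// (cinvK (Vimg _ Vw).1).2.
Qed.

End fibres.

(** * Translation in a groupoid and the theorem *)

Section groupoids.
Variables (R : realType) (X : manifold R).

(** Composition is only the restriction of smooth maps to the composable
    pairs, so one goes through a local extension. *)
Lemma smooth_at_gcomp (G : lieGroupoid X) (M : manifold R) (p q : M -> arrows G) y :
  smooth_at p y -> smooth_at q y -> (\forall z \near y, src (p z) = tgt (q z)) ->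
  smooth_at (fun z => gcomp (p z) (q z)) y.
Proof.
move=> sp sq npq.
have [W [F [oW Wy sF FE]]] :=
  @gcomp_smooth R X G (p y, q y) (nbhs_singleton npq).
have spq := smooth_at_pair sp sq.
apply: smooth_at_ext (smooth_at_comp spq (smooth_in_at oW Wy sF)).
have nW : \forall z \near y, W (p z, q z).
  by apply: (smooth_at_continuous spq); exact: open_nbhs_nbhs.
by apply: filterS2 npq nW => z pqz Wz /=; exact: FE.
Qed.

Variables (Gamma Delta : lieGroupoid X) (phi : lieHom Gamma Delta).
Hypothesis phi_base : forall x : X, hobj phi x = x.

Lemma src_harr g : src (harr phi g) = src g.
Proof. by rewrite harr_src phi_base. Qed.

Lemma tgt_harr g : tgt (harr phi g) = tgt g.
Proof. by rewrite harr_tgt phi_base. Qed.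

(** Arrows with the same image have the same endpoints because [phi] is the
    identity on objects, so injectivity on hom-sets is injectivity on arrows. *)
Lemma fully_faithful_inverse : fully_faithful phi ->
  exists psi, cancel (harr phi) psi /\ cancel psi (harr phi).
Proof.
move=> ff.
have inj : injective (harr phi).
  move=> g g' e; have [_ inj _] := ff (src g) (tgt g).
  apply: inj => //; rewrite inE /homset //=.
  by rewrite -[src g']src_harr -[tgt g']tgt_harr -e src_harr tgt_harr.
have surj h : exists g, harr phi g = h.
  have [_ _ surj] := ff (src h) (tgt h); have [|g _ gh] := surj h; last by exists g.
  by rewrite /homset /= !phi_base.
have [psi psiK] := choice surj; exists psi; split=> // g.
by apply: inj.
Qed.

Variable psi : arrows Delta -> arrows Gamma.
Hypotheses (phiK : cancel (harr phi) psi) (psiK : cancel psi (harr phi)).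

Lemma src_psi h : src (psi h) = src h.
Proof. by rewrite -[in RHS](psiK h) src_harr. Qed.

Lemma tgt_psi h : tgt (psi h) = tgt h.
Proof. by rewrite -[in RHS](psiK h) tgt_harr. Qed.

(** Write an arrow [h] near [h2] as [T h . (T h)^-1 h], where [T h] is an
    arrow with target [tgt h] which depends smoothly on [h] and starts as [k
    = h2 h1^-1]; then [psi] is only evaluated near [h1]. Using a section of
    the target map, rather than a bisection, suffices because [T] need not
    act as a diffeomorphism. *)
Lemma inverse_smooth_translate h1 h2 : src h1 = src h2 ->
  smooth_at psi h1 -> smooth_at psi h2.
Proof.
move=> src12 sm1; pose k := gcomp h2 (ginv h1).
have c21 : src h2 = tgt (ginv h1) by rewrite tgt_inv.
have tgtk : tgt (psi k) = tgt h2 by rewrite tgt_psi tgt_comp.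
have srck : src k = tgt h1 by rewrite src_comp// src_inv.
have kh1 : gcomp k h1 = h2.
  by rewrite /k -gcompA ?src_inv// gcompVg src12 gcompg1.
have [tau [stau tau0 tauK]] := local_section (psi k) (tgt_submersion Gamma).
rewrite tgtk in stau tau0 tauK.
have smtgt : smooth_at (@tgt R X Delta) h2.
  move: h2 {src12 k c21 tgtk srck kh1 stau tau0 tauK}; apply/smooth_at_all.
  exact: (tgt_submersion Delta).1.
have smphi g : smooth_at (harr phi) g by move: g; apply/smooth_at_all; exact: harr_smooth.
have sminv (h : arrows Delta) : smooth_at (@ginv R X Delta) h.
  by move: h; apply/smooth_at_all; exact: ginv_smooth.
pose T (h : arrows Delta) := tau (tgt h).
have smT : smooth_at T h2 by apply: (smooth_at_comp smtgt).
have T2 : T h2 = psi k by [].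
pose A (h : arrows Delta) := ginv (harr phi (T h)).
have smA : smooth_at A h2.
  exact: (smooth_at_comp (smooth_at_comp smT (smphi _)) (sminv _)).
have nT : \forall h \near h2, tgt (T h) = tgt h.
  exact: (smooth_at_continuous smtgt tauK).
have srcA h : tgt (T h) = tgt h -> src (A h) = tgt h.
  by move=> Th; rewrite /A src_inv tgt_harr.
pose B (h : arrows Delta) := gcomp (A h) h.
have smB : smooth_at B h2.
  apply: smooth_at_gcomp => //; first exact: smooth_at_id.
  by apply: filterS nT => h; exact: srcA.
have B2 : B h2 = h1.
  rewrite /B /A T2 psiK -[in X in gcomp _ X]kh1 gcompA ?src_inv//.
  by rewrite gcompVg srck gcomp1g.
pose C (h : arrows Delta) := gcomp (T h) (psi (B h)).
have tgtB h : tgt (T h) = tgt h -> tgt (psi (B h)) = src (T h).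
  by move=> Th; rewrite tgt_psi /B tgt_comp ?srcA// /A tgt_inv src_harr.
have smC : smooth_at C h2.
  apply: smooth_at_gcomp => //.
    by apply: (smooth_at_comp smB); rewrite B2.
  by apply: filterS nT => h /tgtB ->.
apply: smooth_at_ext smC; apply: filterS nT => h Th.
apply: (can_inj phiK); rewrite psiK /C harr_comp ?tgtB// psiK /B.
rewrite gcompA /A; last first.
- by rewrite src_inv tgt_harr.
- by rewrite tgt_inv.
by rewrite gcompgV tgt_harr Th gcomp1g.
Qed.

Lemma inverse_smooth : smooth psi.
Proof.
apply/smooth_at_all => h.
have [h1 src1 sm1] := inverse_smooth_somewhere_in_fibre h (src_submersion Gamma)
  (src_submersion Delta) (@harr_smooth _ _ _ _ _ phi) src_harr phiK psiK.
exact: inverse_smooth_translate sm1.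
Qed.

End groupoids.

Theorem corollaryA7 (R : realType) (X : manifold R) (Gamma Delta : lieGroupoid X)
  (phi : lieHom Gamma Delta)
  (phi_base : forall x : X, hobj phi x = x)
  (phi_ff : fully_faithful phi) :
  lie_isomorphism phi.
Proof.
have [psi [phiK psiK]] := fully_faithful_inverse phi_base phi_ff.
have sm_id : smooth (@id X) by apply/smooth_at_all => x; exact: smooth_at_id.
have psi_unit x : psi (gunit Delta x) = gunit Gamma x.
  by apply: (can_inj phiK); rewrite psiK harr_unit phi_base.
have psi_comp g h : src g = tgt h -> psi (gcomp g h) = gcomp (psi g) (psi h).
  move=> gh; apply: (can_inj phiK).
  by rewrite psiK harr_comp ?psiK// (src_psi phi_base psiK) (tgt_psi phi_base psiK).
exists (@LieHom _ _ _ Delta Gamma id psi sm_id (inverse_smooth phi_base phiK psiK)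
  (src_psi phi_base psiK) (tgt_psi phi_base psiK) psi_unit psi_comp).
by split.
Qed.
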